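(* Let $k$ be an uncountable field, $R$ a commutative finitely generated $k$-algebra, and $\alpha$ a $k$-algebra automorphism of $R$. Let $S=R[\theta;\alpha]$. Then the following are equivalent: (a) $S$ satisfies $(\diamond)$; (b) every simple right $S$-module is finite dimensional as a $k$-vector space.
   Context: $R[\theta;\alpha]$: skew polynomial ring with $\theta r=\alpha(r)\theta$. A ring satisfies $(\diamond)$ if for every simple right module $V$, every finitely generated submodule of the injective hull $E(V)$ is Artinian. *)

(* Defs.v *)
From HB Require Import structures.
From mathcomp Require Import all_boot all_order all_algebra.
Set Implicit Arguments. Unset Strict Implicit. Unset Printing Implicit Defensive.
Import Order.TTheory GRing.Theory Num.Theory.
Local Open Scope ring_scope.

Definition uncountable (T : Type) : Prop :=
  ~ exists f : nat -> T, forall x : T, exists n, f n = x.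

Definition fg_algebra (k : fieldType) (R : comAlgType k) : Prop :=
  exists gs : seq R,
    forall P : R -> Prop,
      (forall c : k, P (c%:A)) ->
      (forall x y, P x -> P y -> P (x + y)) ->
      (forall x y, P x -> P y -> P (x * y)) ->
      (forall g, g \in gs -> P g) ->
      forall r, P r.

Definition is_skew_poly (R : comNzRingType) (S : nzRingType)
    (alpha : R -> R) (iota : R -> S) (theta : S) : Prop :=
  [/\ forall r, theta * iota r = iota (alpha r) * theta,
      forall s : S, exists n (c : 'I_n -> R),
        s = \sum_(i < n) iota (c i) * theta ^+ i
    & forall n (c : 'I_n -> R),
        \sum_(i < n) iota (c i) * theta ^+ i = 0 -> forall i, c i = 0].

(* Right S-modules are modelled as left S^c-modules (S^c the converse ring):
   for v : M and s : S, the right action v.s is  (s : S^c) *: v. *)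

Definition submodule (A : pzRingType) (M : lmodType A) (P : M -> Prop) : Prop :=
  [/\ P 0, (forall x y, P x -> P y -> P (x + y))
    & (forall (a : A) x, P x -> P (a *: x))].

Definition fg_submodule (A : pzRingType) (M : lmodType A) (N : M -> Prop) : Prop :=
  exists gs : seq M, forall x : M,
    N x <-> exists c : 'I_(size gs) -> A, x = \sum_(i < size gs) c i *: gs`_i.

Definition artinian_submodule (A : pzRingType) (M : lmodType A) (N : M -> Prop) : Prop :=
  forall C : nat -> M -> Prop,
    (forall n, submodule (C n)) ->
    (forall x, C 0%N x -> N x) ->
    (forall n x, C n.+1 x -> C n x) ->
    exists m : nat, forall n, (m <= n)%N -> forall x, C n x <-> C m x.

Definition simple_module (A : pzRingType) (V : lmodType A) : Prop :=
  (exists v : V, v != 0) /\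
  forall P : V -> Prop, submodule P -> (forall x, P x -> x = 0) \/ (forall x, P x).

Definition injective_module (A : pzRingType) (E : lmodType A) : Prop :=
  forall (M N : lmodType A) (f : {linear M -> N}) (g : {linear M -> E}),
    injective f -> exists h : {linear N -> E}, forall m, h (f m) = g m.

Definition injective_hull (A : pzRingType) (V E : lmodType A) (f : {linear V -> E}) : Prop :=
  [/\ injective f, injective_module E
    & forall P : E -> Prop, submodule P -> (exists x, P x /\ x != 0) ->
        exists v, v != 0 /\ P (f v)].

Definition diamond (S : nzRingType) : Prop :=
  forall (V E : lmodType S^c) (f : {linear V -> E}),
    simple_module V -> injective_hull f ->
    forall N : E -> Prop, submodule N -> fg_submodule N -> artinian_submodule N.

Definition k_findim (k : fieldType) (R : comAlgType k) (S : nzRingType)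
    (iota : R -> S) (V : lmodType S^c) : Prop :=
  exists vs : seq V, forall v : V,
    exists c : 'I_(size vs) -> k,
      v = \sum_(i < size vs) ((iota (c i)%:A : S) : S^c) *: vs`_i.

(* Main.v *)
Require Import Defs.
From HB Require Import structures.
From mathcomp Require Import all_boot all_order all_algebra.
From mathcomp Require Import boolp classical_sets functions ring.
Set Implicit Arguments. Unset Strict Implicit. Unset Printing Implicit Defensive.
Import GRing.Theory.
Local Open Scope ring_scope.

(** Write [beta] for the inverse of [alpha]; the annihilator in [R] of [v theta^i] is the
    [beta^i]-image of that of [v].

    Finite-dimensional simples imply (diamond).  Let [N] be a finitely generated essential
    extension of the finite-dimensional simple [V].  If [V theta = 0], a Fitting argument shows
    that [theta], and then suitable polynomials in the generators of [R], are nilpotent on [N]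
    and on [ker theta].  Otherwise the annihilator [I] of [V] in [R] is [alpha]-stable and some
    power [theta^n] commutes with [R] modulo [I]; weak Artin-Rees gives [N I^m = 0], and the
    layers of [N] are finite-dimensional, again by Fitting, now applied to a polynomial in
    [theta^n].

    (diamond) implies finite-dimensional simples.  Let [V] be simple with [V theta = V], and
    [v] in [V] with prime annihilator [q].  Since [k] is uncountable one can choose a maximal
    ideal [m] containing [q], with [R/m] algebraic over [k], that avoids countably many elements
    outside [q], so that [V] localised at [m] is free over [R/q] with [v] in a basis.  For [f] in
    [m] outside [q], the hull contains [e] with [e q = 0] and [e f = v]; some multiple [w] of [e]
    has prime annihilator [p] modulo [V] with [f] in [p] inside [m].  If the chain
    [V + w theta^n S] stabilises then [p] is [beta]-periodic.  As [m] is generated by finitely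
    many such [f], [m] is [beta]-periodic, and then its [beta]-core [J] satisfies [V J <> V],
    hence [V J = 0], and [V] is finite-dimensional by Amitsur's trick. *)

(** * Subspaces and chain conditions *)

(** No quotient is ever formed: everything takes place among subspaces, coded as predicates, of one
    [k]-space with operators, and [V] being simple with the ambient module essential over it becomes
    [least_ssub]. The obstacle in the converse is that an arbitrary maximal ideal [m] over [q] may
    satisfy [V m = V]. Filter [V] by the sums of the [v theta^i R] with [i < n]: the layers are
    cyclic modules [R/I_n], and each [I_n] not inside [q] contributes one element for [m] to avoid.
    Then [v] is not in [V m], which separates [V J] from [V] and also keeps the annihilator of [e]
    modulo [V] inside [m]. Uncountability of [k] is used for avoiding these elements and again for
    central operators on [V]. When [V theta = 0] the generators of [R] themselves act centrally and
    Amitsur's trick alone suffices. As (diamond) speaks of given hulls, one has to be constructed: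
    it sits inside the coinduced module [Hom_k(S, V)], whose explicit elements also produce [e]. *)

Section Subspaces.
Variables (k : fieldType) (W : lmodType k).
Implicit Types (P N : W -> Prop) (O : (W -> W) -> Prop) (X Y : W -> W).

Definition subsp P := P 0 /\ forall (c : k) x y, P x -> P y -> P (c *: x + y).

Lemma subsp0 P : subsp P -> P 0. Proof. by case. Qed.

Lemma subspD P x y : subsp P -> P x -> P y -> P (x + y).
Proof. by move=> [_ h] px py; rewrite -[x]scale1r; apply: h. Qed.

Lemma subspZ P c x : subsp P -> P x -> P (c *: x).
Proof. by move=> [p0 h] px; rewrite -[_ *: _]addr0; apply: h. Qed.

Lemma subspN P x : subsp P -> P x -> P (- x).
Proof. by move=> hP px; rewrite -scaleN1r; apply: subspZ. Qed.

Lemma subspB P x y : subsp P -> P x -> P y -> P (x - y).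
Proof. by move=> hP px py; apply: subspD => //; apply: subspN. Qed.

Lemma subsp_sum P (I : Type) (r : seq I) (Q : pred I) (F : I -> W) :
  subsp P -> (forall i, Q i -> P (F i)) -> P (\sum_(i <- r | Q i) F i).
Proof.
move=> hP hF; apply: (big_ind P) => //; first exact: subsp0.
by move=> x y; apply: subspD.
Qed.

Lemma subsp_zero : subsp (fun x : W => x = 0).
Proof. by split=> // c x y -> ->; rewrite scaler0 addr0. Qed.

Lemma subsp_cap P N : subsp P -> subsp N -> subsp (fun x => P x /\ N x).
Proof.
by move=> [p0 pD] [n0 nD]; split=> // c x y [px nx] [py ny]; split; [apply: pD|apply: nD].
Qed.

(** Spans, and later generated submodules, are intersections of all admissible subspaces: a
    membership hypothesis is then itself the induction principle, and is applied as such. *)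
Definition spn (B : W -> Prop) x := forall P, subsp P -> (forall y, B y -> P y) -> P x.

Lemma spn_subsp B : subsp (spn B).
Proof.
split=> [P [] //|c x y hx hy P hP hB].
by case: (hP) => _; apply; [apply: hx|apply: hy].
Qed.

Lemma spn_incl (B : W -> Prop) x : B x -> spn B x.
Proof. by move=> Bx P _; apply. Qed.

Lemma spn_mono (B B' : W -> Prop) x : (forall y, B y -> spn B' y) -> spn B x -> spn B' x.
Proof. by move=> h hx; apply: hx => //; apply: spn_subsp. Qed.

Lemma spn_seqP (vs : seq W) x :
  spn (fun y => y \in vs) x <->
  exists c : 'I_(size vs) -> k, x = \sum_(i < size vs) c i *: vs`_i.
Proof.
split=> [h|[c ->]].
  apply: (h (fun x => exists c : 'I_(size vs) -> k, x = \sum_(i < size vs) c i *: vs`_i)); first split.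
  - by exists (fun=> 0); rewrite big1 // => i _; rewrite scale0r.
  - move=> a _ _ [c ->] [d ->]; exists (fun i => a * c i + d i).
    rewrite scaler_sumr -big_split; apply: eq_bigr => i _ /=.
    by rewrite scalerA scalerDl.
  - move=> y yvs; have lt : (index y vs < size vs)%N by rewrite index_mem.
    exists (fun i => (i == Ordinal lt)%:R).
    rewrite (bigD1 (Ordinal lt)) //= eqxx scale1r nth_index // big1 ?addr0 //.
    by move=> i /negPf ->; rewrite scale0r.
apply: subsp_sum => [|i _]; first exact: spn_subsp.
by apply: (subspZ _ (spn_subsp _)); apply: spn_incl; apply: mem_nth.
Qed.

Definition findim N := exists vs : seq W, forall x, N x -> spn (fun y => y \in vs) x.

Lemma findim_sub N N' : (forall x, N x -> N' x) -> findim N' -> findim N.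
Proof. by move=> h [vs hvs]; exists vs => x /h /hvs. Qed.

Lemma findim_zero : findim (fun x => x = 0).
Proof. by exists [::] => x ->; apply: (subsp0 (spn_subsp _)). Qed.

Lemma findim_spn (vs : seq W) : findim (spn (fun y => y \in vs)).
Proof. by exists vs. Qed.

(** The coefficient matrix has more rows than columns, so its left kernel is nonzero, and a nonzero
    row of [kermx] is the relation. *)
Lemma dependent_family (vs : seq W) n (ys : 'I_n -> W) :
  (size vs < n)%N -> (forall i, spn (fun y => y \in vs) (ys i)) ->
  exists l : 'I_n -> k, (exists i, l i != 0) /\ \sum_i l i *: ys i = 0.
Proof.
move=> lt hy; have /choice [a ha] i := (spn_seqP vs (ys i)).1 (hy i).
pose A := \matrix_(i < n, j < size vs) a i j.
have kn0 : kermx A != 0.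
  rewrite -mxrank_eq0 mxrank_ker subn_eq0 -ltnNge.
  exact: leq_ltn_trans (rank_leq_col A) lt.
have [i [j nz]] : exists i j, kermx A i j != 0.
  apply: contrapT => h; case/eqP: kn0; apply/matrixP => i j; rewrite [RHS]mxE.
  by apply/eqP; apply/negPn/negP => nz; apply: h; exists i, j.
exists (fun j => kermx A i j); split; first by exists j.
have kA : kermx A *m A = 0 by apply: mulmx_ker.
under eq_bigr => l _ do rewrite ha scaler_sumr.
rewrite exchange_big big1 //= => t _.
under eq_bigr => l _ do rewrite scalerA.
rewrite -scaler_suml; suff -> : \sum_l kermx A i l * a l t = 0 by rewrite scale0r.
have h : (kermx A *m A) i t = 0 by rewrite kA mxE.
rewrite -[RHS]h [RHS]mxE.
by apply: eq_bigr => l _; rewrite [A l t]mxE.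
Qed.

Definition stable O P := subsp P /\ forall X, O X -> forall x, P x -> P (X x).

(* [up] selects between ascending and descending chains. *)
Definition chaincond (up : bool) O N := forall C : nat -> W -> Prop,
  (forall n, stable O (C n)) -> (forall n x, C n x -> N x) ->
  (forall n x, if up then C n x -> C n.+1 x else C n.+1 x -> C n x) ->
  exists m, forall n, (m <= n)%N -> forall x, C n x <-> C m x.

Lemma chain_le (up : bool) (C : nat -> W -> Prop) m n x : 
  (forall n x, if up then C n x -> C n.+1 x else C n.+1 x -> C n x) ->
  (m <= n)%N -> if up then C m x -> C n x else C n x -> C m x.
Proof.
move=> h /subnK <-; elim: (n - m)%N => [|d]; first by case: up {h}.
have := h (d + m)%N x; rewrite addSn; case: up {h} => h1 h2 h3.
  by apply: h1; apply: h2.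
by apply: h2; apply: h1.
Qed.

Lemma chaincond_sub up O N N' :
  (forall x, N x -> N' x) -> chaincond up O N' -> chaincond up O N.
Proof. by move=> h hN' C C1 C2 C3; apply: hN' => // n x /C2 /h. Qed.

Lemma chaincond_ops up O O' N :
  (forall P, stable O' P -> stable O P) -> chaincond up O N -> chaincond up O' N.
Proof. by move=> h hN C C1 C2 C3; apply: hN => // n; apply: h. Qed.

(** Two comparable submodules of [N1 + N2] with the same trace on [N1] and the same image modulo
    [N1] coincide. The image is represented inside [N2] by [Q n], the [b] for which some [a + b]
    with [a] in [N1] lies in [C n]. *)
Lemma chaincond_sum up O N1 N2 :
  (forall X, O X -> forall x y, X (x + y) = X x + X y) ->
  stable O N1 -> stable O N2 -> chaincond up O N1 -> chaincond up O N2 ->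
  chaincond up O (fun x => exists a b, [/\ N1 a, N2 b & x = a + b]).
Proof.
move=> addO [s1 o1] [s2 o2] c1 c2 C C1 C2 C3.
have sC n : subsp (C n) by case: (C1 n).
have [m1 h1] : exists m, forall n, (m <= n)%N -> forall x, C n x /\ N1 x <-> C m x /\ N1 x.
  apply: (c1 (fun n x => C n x /\ N1 x)) => [n|n x []|n x] //.
    split; first by apply: subsp_cap.
    by move=> X OX x [Cx Nx]; split; [case: (C1 n) => _; apply|apply: o1].
  by have := C3 n x; case: up {c1 c2 C3} => h [/h].
pose Q n b := N2 b /\ exists2 a, N1 a & C n (a + b).
have [m2 h2] : exists m, forall n, (m <= n)%N -> forall x, Q n x <-> Q m x.
  apply: (c2 Q) => [n|n x []|n x] //.
    split; first split.
    - split; first exact: subsp0.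
      by exists 0; rewrite ?addr0; apply: subsp0.
    - move=> c x y [nx [a na Ca]] [ny [b nb Cb]]; split; first by case: s2 => _; apply.
      exists (c *: a + b); first by case: s1 => _; apply.
      by rewrite addrACA -scalerDr; case: (sC n) => _; apply.
    - move=> X OX x [nx [a na Ca]]; split; first exact: o2.
      by exists (X a); [apply: o1|rewrite -addO //; case: (C1 n) => _; apply].
  rewrite /Q; have h a := C3 n (a + x).
  by case: up {c1 c2 C3 h1} h => h [nx [a na /h Ca]]; split=> //; exists a.
pose m := maxn m1 m2; exists m => n mn.
have m1m : (m1 <= m)%N by rewrite leq_maxl.
have m2m : (m2 <= m)%N by rewrite leq_maxr.
have e1 x : N1 x -> C n x <-> C m x.
  move=> nx; have := h1 n (leq_trans m1m mn) x; have := h1 m m1m x; tauto.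
have e2 x : Q n x <-> Q m x.
  by rewrite h2 ?(leq_trans m2m) // h2.
have incl i j : (forall x, N1 x -> C i x -> C j x) -> (forall x, Q i x -> Q j x) ->
    (forall x, C j x -> C i x) -> forall x, C i x -> C j x.
  move=> k1 k2 k3 x Cx; have [a [b [na nb xab]]] := C2 _ _ Cx.
  have [_ [a' na' Ca']] : Q j b by apply: k2; split=> //; exists a => //; rewrite -xab.
  have -> : x = (a - a') + (a' + b) by rewrite addrA subrK.
  apply: subspD => //; apply: k1; first exact: subspB.
  have -> : a - a' = x - (a' + b) by rewrite xab opprD addrACA subrr addr0.
  by apply: subspB => //; apply: k3.
have := fun x => @chain_le up C m n x C3 mn.
case: up {c1 c2 C3} => le x; split; try exact: le.
- by apply: incl => // y; [move=> ny /e1; apply|move/e2].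
- by apply: incl => // y; [move=> ny /e1; apply|move/e2].
Qed.

Lemma chain_prop (up : bool) (A : nat -> Prop) :
  (forall n, if up then A n -> A n.+1 else A n.+1 -> A n) ->
  exists m, forall n, (m <= n)%N -> A n <-> A m.
Proof.
move=> h; have le m n : (m <= n)%N -> if up then A m -> A n else A n -> A m.
  move/subnK => <-; elim: (n - m)%N => [|d]; first by case: up {h}.
  by have := h (d + m)%N; rewrite addSn; case: up {h} => ? ? ?; auto.
case: up {h} le => le.
  have [[m Am]|nA] := pselect (exists m, A m).
    by exists m => n /le; tauto.
  by exists 0%N => n _; split=> a; case: nA; [exists n|exists 0%N].
have [[m Am]|nA] := pselect (exists m, ~ A m).
  by exists m => n /le; tauto.
by exists 0%N => n _; split=> _; apply: contrapT => a; apply: nA; [exists 0%N|exists n].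
Qed.

Lemma chaincond_line up e : chaincond up (fun _ => False) (fun x => exists c, x = c *: e).
Proof.
move=> C C1 C2 C3; pose A n := exists2 x, C n x & x != 0.
have [m hm] : exists m, forall n, (m <= n)%N -> A n <-> A m.
  apply: (chain_prop (up := up)) => n; rewrite /A; have := C3 n.
  by case: up {C2 C3} => h [x /h Cx nx]; exists x.
exists m => n /hm {}hm x.
have key i j : (A i -> A j) -> C i x -> C j x.
  move=> h Cx; have sj : subsp (C j) by case: (C1 j).
  have [->|nx] := eqVneq x 0; first exact: subsp0.
  have [y Cy ny] : A j by apply: h; exists x.
  have [[c xc] [d yd]] := (C2 _ _ Cx, C2 _ _ Cy).
  have d0 : d != 0 by apply: contraNneq ny => d0; rewrite yd d0 scale0r.
  have -> : x = (c / d) *: y by rewrite xc yd scalerA divfK.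
  exact: subspZ.
by split; apply: key => /hm.
Qed.

Lemma findim_chaincond up N : findim N -> chaincond up (fun _ => False) N.
Proof.
case=> vs hN; apply: chaincond_sub hN _.
elim: vs => [|v vs IH].
  move=> C C1 C2 _; have C0 n x : C n x -> x = 0.
    by move/C2/(_ (fun x => x = 0) subsp_zero); apply.
  exists 0%N => n _ x; split=> /C0 ->; apply: subsp0; first by case: (C1 0%N).
  by case: (C1 n).
apply: chaincond_sub (chaincond_sum _ _ _ (chaincond_line (e := v)) IH) => //.
- move=> x hx; apply: (hx (fun x => exists a b : W,
      [/\ exists c, a = c *: v, spn (fun y => y \in vs) b & x = a + b])); first split.
  + by exists 0, 0; split; rewrite ?addr0 //; [exists 0; rewrite scale0r|apply: (subsp0 (spn_subsp _))].
  + move=> c _ _ [_ [b [[d ->] sb ->]]] [_ [b' [[d' ->] sb' ->]]].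
    exists ((c * d + d') *: v), (c *: b + b'); split; first by exists (c * d + d').
      by apply: (spn_subsp _).2.
    by rewrite scalerDl scalerDr scalerA addrACA.
  + move=> y; rewrite inE => /orP[/eqP ->|yv].
      exists v, 0; rewrite addr0; split=> //; first by exists 1; rewrite scale1r.
      by apply: (subsp0 (spn_subsp _)).
    by exists 0, y; rewrite add0r; split=> //; [exists 0; rewrite scale0r|apply: spn_incl].
- split=> //; split; first by exists 0; rewrite scale0r.
  by move=> c _ _ [d ->] [d' ->]; exists (c * d + d'); rewrite scalerDl scalerA.
- by split=> //; apply: spn_subsp.
Qed.

Definition acc := chaincond true.

(** Without a maximal member, choice puts a strictly larger one above each member of [F], and
    iteration from [P0] gives a chain that never stabilises. *)
Lemma acc_max O N (F : (W -> Prop) -> Prop) P0 :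
  acc O N -> (forall P, F P -> stable O P /\ forall x, P x -> N x) -> F P0 ->
  exists2 P, F P & forall Q, F Q -> (forall x, P x -> Q x) -> forall x, Q x -> P x.
Proof.
move=> hN hF FP0; apply: contrapT => nmax.
have step (P : {P | F P}) : exists Q : {P | F P},
    (forall x, sval P x -> sval Q x) /\ exists2 x, sval Q x & ~ sval P x.
  case: P => P FP /=; apply: contrapT => nQ; apply: nmax; exists P => // Q FQ PQ x Qx.
  by apply: contrapT => nPx; apply: nQ; exists (exist _ Q FQ); split=> //=; exists x.
have [nxt hnxt] := choice step.
pose C n := sval (iter n nxt (exist _ P0 FP0)).
have [||n x|m hm] := hN C.
- by move=> n; apply: (hF _ (svalP (iter n nxt _))).1.
- by move=> n; apply: (hF _ (svalP (iter n nxt _))).2.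
- by move=> h; apply: (hnxt _).1.
have [_ [x Cx nCx]] := hnxt (iter m nxt (exist _ P0 FP0)).
by apply: nCx; apply: (hm m.+1 _ x).1.
Qed.

Definition generated O (vs : seq W) x := forall P, stable O P -> (forall v, v \in vs -> P v) -> P x.

Lemma generated_stable O vs : stable O (generated O vs).
Proof.
split; first split.
- by move=> P [] [].
- by move=> c x y hx hy P hP hv; case: (hP) => -[_ h] _; apply: h; [apply: hx|apply: hy].
- by move=> X OX x hx P hP hv; case: (hP) => _; apply=> //; apply: hx.
Qed.

(** A maximal finitely generated submodule of [N] absorbs every further generator. *)
Lemma acc_fg O N : acc O N -> stable O N ->
  exists vs : seq W, (forall v, v \in vs -> N v) /\ forall x, N x -> generated O vs x.
Proof.
move=> aN sN.
pose F P := exists2 vs : seq W, (forall v, v \in vs -> N v) & P = generated O vs.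
have [||P [vs vsN ->] hmax] := @acc_max O N F (generated O [::]) aN.
- by move=> P [vs vsN ->]; split; [apply: generated_stable|move=> x; apply].
- by exists [::].
exists vs; split=> // x Nx; apply: (hmax (generated O (x :: vs))).
- by exists (x :: vs) => // v; rewrite inE => /orP[/eqP ->|/vsN].
- by move=> y hy Q hQ hv; apply: hy => // v vvs; apply: hv; rewrite inE vvs orbT.
- by move=> Q hQ; apply; rewrite inE eqxx.
Qed.

Lemma findim_basis N : subsp N -> findim N ->
  exists vs : seq W, (forall v, v \in vs -> N v) /\ forall x, N x -> spn (fun y => y \in vs) x.
Proof.
move=> sN fN; have [vs [vsN h]] := @acc_fg (fun _ => False) N (findim_chaincond fN) (conj sN (fun _ => False_ind _)).
by exists vs; split=> // x /h hx P hP; apply: hx.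
Qed.

End Subspaces.

(** * Adjoining operators *)

Section Operators.
Variables (k : fieldType) (W : lmodType k).
Implicit Types (P N : W -> Prop) (O : (W -> W) -> Prop) (X Y : W -> W).

Definition lin X := forall (c : k) x y, X (c *: x + y) = c *: X x + X y.

Lemma linD X x y : lin X -> X (x + y) = X x + X y.
Proof. by move=> h; rewrite -[x]scale1r h !scale1r. Qed.

Lemma lin0 X : lin X -> X 0 = 0.
Proof. by move=> h; apply: (addrI (X 0)); rewrite -linD // !addr0. Qed.

Lemma linZ X c x : lin X -> X (c *: x) = c *: X x.
Proof. by move=> h; rewrite -[c *: x]addr0 h lin0 // addr0. Qed.

Lemma linN X x : lin X -> X (- x) = - X x.
Proof. by move=> h; rewrite -scaleN1r linZ // scaleN1r. Qed.

Lemma linB X x y : lin X -> X (x - y) = X x - X y.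
Proof. by move=> h; rewrite linD // linN. Qed.

Lemma lin_sum X (I : Type) (r : seq I) (Q : pred I) (F : I -> W) :
  lin X -> X (\sum_(i <- r | Q i) F i) = \sum_(i <- r | Q i) X (F i).
Proof. by move=> h; apply: big_morph; [move=> x y; apply: linD|apply: lin0]. Qed.

Lemma lin_iter X n : lin X -> lin (iter n X).
Proof. by move=> h; elim: n => [|n IH] c x y //=; rewrite IH h. Qed.

Lemma subsp_preim X P : lin X -> subsp P -> subsp (fun x => P (X x)).
Proof.
by move=> hX [p0 pD]; split=> [|c x y px py]; rewrite ?lin0 // hX; apply: pD.
Qed.

Lemma subsp_im X P : lin X -> subsp P -> subsp (fun y => exists2 x, P x & y = X x).
Proof.
move=> hX [p0 pD]; split=> [|c _ _ [x px ->] [y py ->]]; first by exists 0; rewrite ?lin0.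
by exists (c *: x + y); rewrite ?hX //; apply: pD.
Qed.

Lemma findim_ker_im X N : lin X -> subsp N ->
  findim (fun y => exists2 x, N x & y = X x) -> findim (fun x => N x /\ X x = 0) -> findim N.
Proof.
move=> hX sN fI [us hus].
have [vs [vsI hvs]] := findim_basis (subsp_im hX sN) fI.
have /choice [g hg] v : exists x, v \in vs -> N x /\ v = X x.
  have [/vsI [x Nx ->]|] := boolP (v \in vs); last by exists 0.
  by exists x.
exists (map g vs ++ us) => x Nx.
pose G y := y \in map g vs ++ us; rewrite -/(spn G x); have sG : subsp (spn G) by apply: spn_subsp.
pose Q y := exists2 x', N x' /\ spn G x' & y = X x'.
have [x' [Nx' Gx'] e] : Q (X x).
  have : spn (fun y => y \in vs) (X x) by apply: hvs; exists x.
  apply; first by apply: (subsp_im hX); apply: subsp_cap.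
  move=> v vvs; have [Ng vX] := hg v vvs; exists (g v) => //; split=> //.
  by apply: spn_incl; rewrite /G mem_cat map_f.
have -> : x = (x - x') + x' by rewrite subrK.
apply: (subspD sG _ Gx'); apply: (@spn_mono _ _ (fun y => y \in us)).
  by move=> y yus; apply: spn_incl; rewrite /G mem_cat yus orbT.
by apply: hus; split; [apply: subspB|rewrite linB // e subrr].
Qed.

(** Values of polynomials of degree below [n] in [X] with coefficients in [N], leading term split
    off. The coefficients are not determined by the value. *)
Fixpoint adjoin_le N X n : W -> Prop :=
  if n is n'.+1 then fun m => exists c m', [/\ N c, adjoin_le N X n' m' & m = iter n' X c + m']
  else fun m => m = 0.

Definition adjoin N X m := exists n, adjoin_le N X n m.

Section Adjoin.
Variables (N : W -> Prop) (X : W -> W).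
Hypotheses (sN : subsp N) (lX : lin X).

Lemma adjoin_le_subsp n : subsp (adjoin_le N X n).
Proof.
elim: n => [|n [IH0 IHD]] /=; first exact: subsp_zero.
split; first by exists 0, 0; rewrite (lin0 (lin_iter n lX)) addr0; split=> //; apply: subsp0.
move=> c _ _ [a [a' [Na da ->]]] [b [b' [Nb db ->]]].
exists (c *: a + b), (c *: a' + b'); split; [by case: sN => _; apply|exact: IHD|].
by rewrite (lin_iter n lX) scalerDr addrACA.
Qed.

Lemma adjoin_leS n m : adjoin_le N X n m -> adjoin_le N X n.+1 m.
Proof.
by move=> h; exists 0, m; split=> //; [apply: subsp0|rewrite (lin0 (lin_iter n lX)) add0r].
Qed.

Lemma adjoin_le_mono n n' m : (n <= n')%N -> adjoin_le N X n m -> adjoin_le N X n' m.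
Proof. by move/subnK <-; elim: (n' - n)%N => // d IH /IH; apply: adjoin_leS. Qed.

Lemma adjoin_le_op n m : adjoin_le N X n m -> adjoin_le N X n.+1 (X m).
Proof.
elim: n m => [|n IH] m.
  by move=> ->; rewrite lin0 //; exact: subsp0 (adjoin_le_subsp 1).
case=> c [m' [Nc dm' ->]]; exists c, (X m'); split=> //; first exact: IH.
by rewrite linD.
Qed.

Lemma adjoin_subsp : subsp (adjoin N X).
Proof.
split; first by exists 0%N.
move=> c x y [n dx] [n' dy]; exists (maxn n n'); apply: (adjoin_le_subsp _).2.
  by apply: adjoin_le_mono dx; rewrite leq_maxl.
by apply: adjoin_le_mono dy; rewrite leq_maxr.
Qed.

Lemma adjoin_op m : adjoin N X m -> adjoin N X (X m).
Proof. by case=> n /adjoin_le_op; exists n.+1. Qed.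

Lemma adjoin_incl m : N m -> adjoin N X m.
Proof. by move=> Nm; exists 1%N, m, 0; rewrite addr0. Qed.

Lemma adjoin_min P m : subsp P -> (forall x, N x -> P x) -> (forall x, P x -> P (X x)) ->
  adjoin N X m -> P m.
Proof.
move=> sP NP XP [n]; elim: n m => [m ->|n IH m [c [m' [Nc /IH Pm' ->]]]]; first exact: subsp0.
by apply: subspD => //; elim: n {IH} => [|n IH] /=; [apply: NP|apply: XP].
Qed.

Variable O : (W -> W) -> Prop.
Hypothesis sO : stable O N.
Hypothesis linO : forall Y, O Y -> lin Y.
(** [commr] moves [Y] inwards past [X], which makes [adjoin N X] stable; [comml] moves it outwards,
    which makes the spaces of leading coefficients stable. *)
Hypothesis commr : forall Y, O Y -> exists2 Y', O Y' & forall x, Y (X x) = X (Y' x).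
Hypothesis comml : forall Y, O Y -> exists2 Y', O Y' & forall x, Y' (X x) = X (Y x).

Lemma commr_iter n Y : O Y -> exists2 Y', O Y' & forall x, Y (iter n X x) = iter n X (Y' x).
Proof.
elim: n Y => [|n IH] Y OY; first by exists Y.
have [Y1 OY1 h1] := commr OY; have [Y2 OY2 h2] := IH _ OY1.
by exists Y2 => // x; rewrite !iterS h1 h2.
Qed.

Lemma comml_iter n Y : O Y -> exists2 Y', O Y' & forall x, Y' (iter n X x) = iter n X (Y x).
Proof.
elim: n Y => [|n IH] Y OY; first by exists Y.
have [Y1 OY1 h1] := IH _ OY; have [Y2 OY2 h2] := comml OY1.
by exists Y2 => // x; rewrite !iterS h2 h1.
Qed.

Lemma adjoin_le_stable n Y m : O Y -> adjoin_le N X n m -> adjoin_le N X n (Y m).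
Proof.
move=> OY; elim: n m => [|n IH] m; first by move=> ->; rewrite /= (lin0 (linO OY)).
move=> [c [m' [Nc dm' ->]]]; have [Y' OY' h] := commr_iter n OY.
exists (Y' c), (Y m'); split; [by case: sO => _; apply|exact: IH|].
by rewrite (linD _ _ (linO OY)) h.
Qed.

Definition addop Y := O Y \/ Y = X.

Lemma adjoin_stable : stable addop (adjoin N X).
Proof.
split; first exact: adjoin_subsp.
move=> Y [OY m [n dm]|-> m]; last exact: adjoin_op.
by exists n; apply: adjoin_le_stable.
Qed.

(* Hilbert's basis theorem, by stabilising the modules of leading coefficients. *)
Lemma adjoin_acc : acc O N -> acc addop (adjoin N X).
Proof.
move=> accN C C1 C2 C3.
have sC n : subsp (C n) by case: (C1 n).
have CX n x : C n x -> C n (X x) by case: (C1 n) => _; apply; right.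
have CO n Y x : O Y -> C n x -> C n (Y x) by move=> OY; case: (C1 n) => _; apply; left.
have Cle i j x : (i <= j)%N -> C i x -> C j x by move=> ij; apply: (@chain_le _ _ true C i j x C3 ij).
(* Leading coefficients of the elements of [C j] of degree at most [n]. *)
pose lc n j a := N a /\ exists2 m, adjoin_le N X n m & C j (iter n X a + m).
have slc n j : stable O (lc n j).
  split; first split.
  - split; first exact: subsp0.
    exists 0; first exact: subsp0 (adjoin_le_subsp n).
    by rewrite addr0 (lin0 (lin_iter n lX)); apply: subsp0.
  - move=> c x y [Nx [a da Ca]] [Ny [b db Cb]]; split; first by apply: sN.2.
    exists (c *: a + b); first exact: (adjoin_le_subsp n).2.
    by rewrite (lin_iter n lX) addrACA -scalerDr; apply: (sC j).2.
  - move=> Y OY x [Nx [a da Ca]]; split; first by case: sO => _; apply.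
    have [Y' OY' h] := comml_iter n OY.
    exists (Y' a); first exact: adjoin_le_stable.
    by rewrite -h -(linD _ _ (linO OY')); apply: CO.
have lcN n j x : lc n j x -> N x by case.
have lcS n j x : lc n j x -> lc n.+1 j x.
  case=> Nx [a da Ca]; split=> //; exists (X a); first exact: adjoin_le_op.
  by rewrite iterS -linD //; apply: CX.
have lcj n i j x : (i <= j)%N -> lc n i x -> lc n j x.
  by move=> ij [Nx [a da /(Cle _ _ _ ij)]]; split=> //; exists a.
have lcn n n' j x : (n <= n')%N -> lc n j x -> lc n' j x.
  by move/subnK <-; elim: (n' - n)%N => // d IH /IH; apply: lcS.
(* The diagonal chain settles all degrees from [n0] on at once; the finitely many degrees below [n0]
   get individual bounds [js n]. *)
have [n0 hn0] : exists n0, forall n, (n0 <= n)%N -> forall x, lc n n x <-> lc n0 n0 x.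
  apply: (accN (fun n => lc n n)) => // [n|n x] /=; first exact: lcN.
  by move=> h; apply: lcS; apply: lcj h.
have big n j x : (n0 <= n)%N -> lc n j x -> lc n n0 x.
  move=> nn h; apply: (lcn n0) => //; apply: (hn0 (maxn n j) _ x).1.
    by rewrite (leq_trans nn) ?leq_maxl.
  by apply: (lcn n); rewrite ?leq_maxl //; apply: lcj h; rewrite leq_maxr.
have /choice [js hjs] n : exists m, forall j, (m <= j)%N -> forall x, lc n j x <-> lc n m x.
  apply: (accN (lc n)) => // [j|j x] /=; first exact: lcN.
  exact: lcj.
pose j0 := maxn n0 (\max_(i < n0) js i); exists j0 => j jj0 x.
split; last exact: Cle.
have lcall n y : lc n j y -> lc n j0 y.
  have [nn|nn] := leqP n0 n.
    by move=> /(big _ _ _ nn); apply: lcj; rewrite leq_maxl.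
  have jn : (js n <= j0)%N.
    rewrite /j0 leq_max; apply/orP; right.
    exact: (leq_bigmax (Ordinal nn)).
  by move/(hjs n j (leq_trans jn jj0)) => h; apply: lcj h.
move=> Cx; have [n dx] := C2 _ _ Cx; elim: n x dx Cx => [x -> _|n IH x].
  exact: subsp0.
case=> c [m' [Nc dm' ->]] Cx.
have [_ [m dm Cm]] : lc n j0 c by apply: lcall; split=> //; exists m'.
have -> : iter n X c + m' = (m' - m) + (iter n X c + m).
  by rewrite [RHS]addrACA addNr addr0 addrC.
apply: subspD => //; apply: IH; first by apply: subspB => //; apply: adjoin_le_subsp.
have -> : m' - m = (iter n X c + m') - (iter n X c + m).
  by rewrite opprD addrACA subrr add0r.
by apply: subspB => //; apply: Cle Cm.
Qed.

End Adjoin.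
End Operators.

(** * Polynomials in an operator, countable dimension *)

Section OperatorPolynomials.
Variables (k : fieldType) (W : lmodType k).
Implicit Types (P N U : W -> Prop) (X Y : W -> W) (p q : {poly k}).

Definition papp X p w := \sum_(i < size p) p`_i *: iter i X w.

Lemma papp_wide X p n w : (size p <= n)%N -> papp X p w = \sum_(i < n) p`_i *: iter i X w.
Proof.
move=> le; rewrite /papp (big_ord_widen n (fun i => p`_i *: iter i X w)) //.
rewrite big_mkcond; apply: eq_bigr => i _; case: ifPn => //.
by rewrite -leqNgt => h; rewrite nth_default // scale0r.
Qed.

Lemma papp_linl X c p q w : papp X (c *: p + q) w = c *: papp X p w + papp X q w.
Proof.
pose n := maxn (size p) (size q).
rewrite (@papp_wide _ p n) ?leq_maxl // (@papp_wide _ q n) ?leq_maxr //.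
rewrite (@papp_wide _ _ n); last first.
  by apply: leq_trans (size_polyD _ _) _; rewrite geq_max leq_maxr leq_max size_scale_leq.
rewrite scaler_sumr -big_split; apply: eq_bigr => i _ /=.
by rewrite coefD coefZ scalerDl scalerA.
Qed.

Lemma papp0 X w : papp X 0 w = 0.
Proof. by rewrite /papp size_poly0 big_ord0. Qed.

Lemma pappD X p q w : papp X (p + q) w = papp X p w + papp X q w.
Proof. by rewrite -[p]scale1r papp_linl !scale1r. Qed.

Lemma pappZ X c p w : papp X (c *: p) w = c *: papp X p w.
Proof. by rewrite -[c *: p]addr0 papp_linl papp0 addr0. Qed.

Lemma papp_sum X (I : Type) (r : seq I) (F : I -> {poly k}) w :
  papp X (\sum_(i <- r) F i) w = \sum_(i <- r) papp X (F i) w.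
Proof.
by apply: (big_morph (fun p => papp X p w)); [move=> p q; apply: pappD|apply: papp0].
Qed.

Lemma pappC X c w : papp X c%:P w = c *: w.
Proof. by rewrite (@papp_wide _ _ 1) ?size_polyC_leq1 // big_ord1 coefC. Qed.

Lemma papp_mulX X p w : papp X ('X * p) w = papp X p (X w).
Proof.
rewrite (@papp_wide _ _ (size p).+1); last first.
  by apply: leq_trans (size_polyMleq _ _) _; rewrite size_polyX.
rewrite big_ord_recl coefXM eqxx scale0r add0r; apply: eq_bigr => i _.
by rewrite coefXM /= -iterS iterSr.
Qed.

Lemma pappX X w : papp X 'X w = X w.
Proof. by rewrite -['X]mulr1 papp_mulX pappC scale1r. Qed.

Lemma papp_XsubC X c w : papp X ('X - c%:P) w = X w - c *: w.
Proof. by rewrite -polyCN pappD pappX pappC scaleNr. Qed.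

Lemma papp_comm X Y p w : lin Y -> (forall x, Y (X x) = X (Y x)) ->
  Y (papp X p w) = papp X p (Y w).
Proof.
move=> lY YX; rewrite lin_sum //; apply: eq_bigr => i _; rewrite linZ //; congr (_ *: _).
by elim: (nat_of_ord i) => //= n <-.
Qed.

Lemma papp_lin X p : lin X -> lin (papp X p).
Proof.
move=> lX c x y; rewrite /papp scaler_sumr -big_split; apply: eq_bigr => i _ /=.
by rewrite (lin_iter i lX) scalerDr !scalerA mulrC.
Qed.

Lemma papp_mul X p q w : lin X -> papp X (p * q) w = papp X p (papp X q w).
Proof.
move=> lX; elim/poly_ind: p w => [|p c IH] w; first by rewrite mul0r !papp0.
rewrite mulrDl !pappD mul_polyC pappZ pappC; congr (_ + _).
rewrite -mulrA mulrCA papp_mulX IH [p * 'X]mulrC papp_mulX; congr (papp X p _).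
by rewrite papp_comm.
Qed.

Lemma papp_exp X p n w : lin X -> papp X (p ^+ n) w = iter n (papp X p) w.
Proof.
by move=> lX; elim: n => [|n IH]; [rewrite expr0 pappC scale1r|rewrite exprS papp_mul // IH].
Qed.

Lemma papp_stable X p U x : subsp U -> (forall x, U x -> U (X x)) -> U x -> U (papp X p x).
Proof.
move=> sU UX Ux; apply: subsp_sum => // i _; apply: subspZ => //.
by elim: (nat_of_ord i) => //= n; apply: UX.
Qed.

Lemma papp_compXn X p n w : papp X (p \Po 'X^n) w = papp (iter n X) p w.
Proof.
rewrite comp_polyE papp_sum; apply: eq_bigr => i _; rewrite pappZ; congr (_ *: _).
rewrite -exprM; elim: (nat_of_ord i) w => [|j IH] w; first by rewrite muln0 expr0 pappC scale1r.
rewrite mulnS exprD iterSr -IH; move: 'X^(n * j) => r; elim: n {IH} w => [|m IHm] w; first by rewrite mul1r.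
by rewrite exprS -mulrA papp_mulX IHm -iterSr.
Qed.

Lemma findim_adjoin N X p : subsp N -> lin X -> findim N -> p != 0 ->
  (forall x, N x -> papp X p x = 0) -> findim (adjoin N X).
Proof.
move=> sN lX fN p0 hp; have [vs [vsN hvs]] := findim_basis sN fN.
pose us := [seq iter i X v | i <- iota 0 (size p), v <- vs].
exists us => x; set G := spn _; have sG : subsp G by apply: spn_subsp.
have Gi i v : (i < size p)%N -> v \in vs -> G (iter i X v).
  by move=> ip vv; apply: spn_incl; apply/allpairsP; exists (i, v); rewrite mem_iota.
apply: adjoin_min => // [y /hvs|y Gy].
  by apply=> // v; apply: Gi 0%N v _; rewrite lt0n size_poly_eq0.
apply: (Gy (fun y => G (X y))); first exact: subsp_preim.
move=> _ /allpairsP[[i v] /= [ii vv ->]]; move: ii; rewrite mem_iota add0n /= => ip.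
rewrite -iterS; have [lt|ge] := ltnP i.+1 (size p); first exact: Gi.
(* Here [i] is the degree of [p]: the relation [p(X) v = 0] trades [X^i v] for lower powers before
   [X] is applied. *)
have sp : size p = i.+1 by apply/eqP; rewrite eqn_leq ge ip.
have := hp _ (vsN _ vv); rewrite /papp sp big_ord_recr /= => /eqP; rewrite addr_eq0 => /eqP e.
have lc : p`_i != 0 by have := p0; rewrite -lead_coef_eq0 lead_coefE sp.
have -> : iter i X v = - (p`_i)^-1 *: \sum_(j < i) p`_j *: iter j X v.
  by rewrite e scaleNr scalerN opprK scalerA mulVf // scale1r.
rewrite linZ //; apply: (subspZ _ sG); rewrite lin_sum //; apply: (subsp_sum _ sG) => j _.
by rewrite linZ //; apply: (subspZ _ sG); rewrite -iterS; apply: Gi => //; rewrite sp ltnS.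
Qed.

(** The sequence only has to span a space containing [N], so the property passes to subspaces at
    once. *)
Definition cdim N := exists b : nat -> W, forall x, N x -> spn (fun y => exists n, y = b n) x.

Lemma findim_cdim N : findim N -> cdim N.
Proof.
case=> vs hvs; exists (nth 0 vs) => x /hvs; apply: spn_mono => y /(nthP 0)[i _ <-].
by apply: spn_incl; exists i.
Qed.

Lemma cdim_adjoin N X : subsp N -> lin X -> cdim N -> cdim (adjoin N X).
Proof.
move=> sN lX [b hb].
exists (fun n => if @unpickle (nat * nat)%type n is Some (i, j) then iter i X (b j) else 0) => x.
set G := spn _; have sG : subsp G by apply: spn_subsp.
have Gi i j : G (iter i X (b j)).
  by apply: spn_incl; exists (pickle (i, j)); rewrite pickleK.
apply: adjoin_min => // [y /hb|y Gy].
  by apply=> // _ [n ->]; apply: (Gi 0%N).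
apply: (Gy (fun y => G (X y))); first exact: subsp_preim.
move=> _ [n ->]; case: unpickle => [[i j]|]; first exact: Gi i.+1 j.
by rewrite lin0 //; apply: (subsp0 sG).
Qed.

Lemma cdim_finite_part (b : nat -> W) x : spn (fun y => exists n, y = b n) x ->
  exists n, spn (fun y => y \in mkseq b n) x.
Proof.
have mono n n' y : (n <= n')%N -> spn (fun y => y \in mkseq b n) y -> spn (fun y => y \in mkseq b n') y.
  move=> le; apply: spn_mono => z /mapP[i]; rewrite mem_iota => /= ii ->.
  by apply: spn_incl; apply: map_f; rewrite mem_iota /= (leq_trans ii).
move=> hx; apply: (hx (fun x => exists n, spn (fun y => y \in mkseq b n) x)); first split.
- by exists 0%N; apply: (subsp0 (spn_subsp _)).
- move=> c y z [n hy] [n' hz]; exists (maxn n n'); apply: (spn_subsp _).2.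
    by apply: mono hy; rewrite leq_maxl.
  by apply: mono hz; rewrite leq_maxr.
- move=> _ [n ->]; exists n.+1; apply: spn_incl; apply: map_f.
  by rewrite mem_iota /=.
Qed.

End OperatorPolynomials.

(** If each fibre over [(n, m)] had at most [m] elements, [K] would be a countable union of finite
    sets. A fibre of size [m + 1] is what beats a space spanned by [m] vectors in Amitsur's
    trick. *)
Lemma uncountable_fiber (K : fieldType) (d : K -> nat * nat) : uncountable K ->
  exists n m (cs : seq K), [/\ uniq cs, size cs = m.+1 & forall c, c \in cs -> d c = (n, m)].
Proof.
move=> unc; apply: contrapT => none; apply: unc.
have cover (F : K -> Prop) D :
    (forall cs, uniq cs -> (forall c, c \in cs -> F c) -> size cs <> D) ->
    exists l : seq K, forall c, F c -> c \in l.
  move=> hD; apply: contrapT => nl.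
  have [cs [u sz hF]] : exists cs, [/\ uniq cs, size cs = D & forall c, c \in cs -> F c].
    elim: (D) => [|D' [cs [u sz hF]]]; first by exists [::].
    have [c Fc nc] : exists2 c, F c & c \notin cs.
      apply: contrapT => h; apply: nl; exists cs => c Fc.
      by apply/negPn/negP => nc; apply: h; exists c.
    exists (c :: cs); rewrite /= nc u sz; split=> // c'; rewrite inE => /orP[/eqP ->|] //.
    exact: hF.
  exact: (hD cs).
have /choice [l hl] (nm : nat * nat) : exists l : seq K, forall c, d c = nm -> c \in l.
  apply: (cover _ nm.2.+1) => cs u hF sz; apply: none.
  by exists nm.1, nm.2, cs; split=> // c /hF ->; case: nm {hF sz}.
exists (fun N => if @unpickle (nat * nat * nat)%type N is Some (nm, i) then nth 0 (l nm) i else 0).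
move=> x; exists (pickle (d x, index x (l (d x)))); rewrite pickleK nth_index //.
exact: hl.
Qed.

(** * Amitsur's trick *)

Section Amitsur.
Variables (k : fieldType) (W : lmodType k).

(* The vectors [(X - c)^-1 sigma] are uncountably many in a space of countable dimension. *)
Lemma countable_dim_algebraic (X : W -> W) (N U : W -> Prop) (sigma : nat -> W) :
  uncountable k -> cdim N -> lin X -> subsp U -> (forall x, U x -> U (X x)) ->
  (forall c, exists y n, N y /\ U (X y - c *: y - sigma n)) ->
  exists n p, p != 0 /\ U (papp X p (sigma n)).
Proof.
move=> unc [b hb] lX sU UX hc.
have /choice [f hf] c : exists f : W * nat * nat,
    U (X f.1.1 - c *: f.1.1 - sigma f.1.2) /\ spn (fun y => y \in mkseq b f.2) f.1.1.
  have [y [n [Ny Uy]]] := hc c; have [m hm] := cdim_finite_part (hb y Ny).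
  by exists (y, n, m).
have [n [m [cs [ucs sz hcs]]]] := @uncountable_fiber k (fun c => ((f c).1.2, (f c).2)) unc.
have csi (i : 'I_m.+1) : cs`_i \in cs by rewrite mem_nth // sz.
have [||l [[i0 l0] rel]] := @dependent_family _ _ (mkseq b m) m.+1 (fun i => (f cs`_i).1.1).
- by rewrite size_mkseq.
- by move=> i; have := (hf cs`_i).2; case: (hcs _ (csi i)) => _ ->.
(* Applying the product of all [X - c_j] to the linear relation turns its [i]-th term into [l i]
   times [Q i] applied to [sigma n], modulo [U]. The resulting polynomial is nonzero because at
   [c_i0] only its [i0]-th term survives. *)
pose Q (i : 'I_m.+1) := \prod_(j < m.+1 | j != i) ('X - (cs`_j)%:P).
exists n, (\sum_i l i *: Q i); split.
  apply: contra_neq (_ : l i0 * \prod_(j < m.+1 | j != i0) (cs`_i0 - cs`_j) != 0); last first.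
    rewrite mulf_neq0 //; apply/prodf_neq0 => j ji; rewrite subr_eq0.
    by rewrite nth_uniq ?sz // eq_sym.
  move=> e; have := congr1 (fun p => p.[cs`_i0]) e; rewrite horner0 horner_sum.
  rewrite (bigD1 i0) //= big1 ?addr0 => [h|i ii0].
    by rewrite -[RHS]h hornerZ horner_prod; congr (_ * _); apply: eq_bigr => j _; rewrite !hornerE.
  by rewrite hornerZ horner_prod (bigD1 i0) 1?eq_sym //= hornerXsubC subrr mul0r mulr0.
pose QQ := \prod_(j < m.+1) ('X - (cs`_j)%:P).
have Qi i : QQ = Q i * ('X - (cs`_i)%:P) by rewrite /QQ (bigD1 i) //= mulrC.
have e : \sum_i l i *: papp X QQ (f cs`_i).1.1 = 0.
  have lQ := papp_lin QQ lX; transitivity (papp X QQ (\sum_i l i *: (f cs`_i).1.1)).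
    by rewrite (lin_sum _ _ _ lQ); apply: eq_bigr => i _; rewrite (linZ _ _ lQ).
  by rewrite rel lin0.
have -> : papp X (\sum_i l i *: Q i) (sigma n) =
    - \sum_i (l i *: papp X QQ (f cs`_i).1.1 - papp X (l i *: Q i) (sigma n)).
  by rewrite sumrB e sub0r opprK papp_sum.
apply: subspN => //.
apply: subsp_sum => // i _; rewrite pappZ -scalerBr; apply: subspZ => //.
rewrite (Qi i) papp_mul // papp_XsubC -linB; last exact: papp_lin.
apply: papp_stable => //; have := (hf cs`_i).1.
by case: (hcs _ (csi i)) => -> _.
Qed.

End Amitsur.

(** * Iterated adjunction of commuting operators *)

Section MultiAdjoin.
Variables (k : fieldType) (W : lmodType k) (T : eqType) (F : T -> W -> W).
Hypotheses (lF : forall t, lin (F t)) (cF : forall s t x, F s (F t x) = F t (F s x)).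

Definition madjoin N (s : seq T) : W -> Prop := foldr (fun t N => adjoin N (F t)) N s.

Variable N : W -> Prop.
Hypothesis sN : subsp N.

Lemma madjoin_subsp s : subsp (madjoin N s).
Proof. by elim: s => //= t s IH; apply: adjoin_subsp. Qed.

Lemma madjoin_incl s x : N x -> madjoin N s x.
Proof. by move=> Nx; elim: s => //= t s; apply: adjoin_incl. Qed.

Lemma madjoin_min P s x : subsp P -> (forall x, N x -> P x) ->
  (forall t x, t \in s -> P x -> P (F t x)) -> madjoin N s x -> P x.
Proof.
move=> sP NP; elim: s x => [x _|t s IH x h]; first exact: NP.
apply: adjoin_min => // [y|y]; last by apply: h; rewrite inE eqxx.
by apply: IH => t' z ts; apply: h; rewrite inE ts orbT.
Qed.

Definition ops_of (s : seq T) Y := exists2 t, t \in s & Y = F t.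

Lemma madjoin_stable s : stable (ops_of s) (madjoin N s).
Proof.
split; first exact: madjoin_subsp.
elim: s => [|t s IH] Y [t' //]; rewrite inE => /orP[/eqP -> -> x|ts -> x].
  by apply: adjoin_op => //; apply: madjoin_subsp.
case=> n d; exists n; move: d; apply: (adjoin_le_stable (O := ops_of s)).
- by split; [apply: madjoin_subsp|apply: IH].
- by move=> _ [t1 _ ->].
- by move=> _ [t1 st1 ->]; exists (F t1) => //; exists t1.
- by exists t'.
Qed.

Lemma madjoin_acc s : findim N -> acc (ops_of s) (madjoin N s).
Proof.
move=> fN; elim: s => [|t s IH].
  by apply: chaincond_ops (findim_chaincond fN) => P [sP _].
have : acc (addop (F t) (ops_of s)) (adjoin (madjoin N s) (F t)).
  apply: adjoin_acc => //.
  - exact: madjoin_subsp.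
  - exact: madjoin_stable.
  - by move=> _ [t1 _ ->].
  - by move=> _ [t1 st1 ->]; exists (F t1) => //; exists t1.
  - by move=> _ [t1 st1 ->]; exists (F t1) => //; exists t1.
apply: chaincond_ops => P [sP hP]; split=> // Y [[t1 st1 ->]|->]; apply: hP.
  by exists t1; rewrite // inE st1 orbT.
by exists t; rewrite // inE eqxx.
Qed.

Lemma madjoin_findim s : findim N ->
  (forall t, t \in s -> exists2 p, p != 0 & forall x, N x -> papp (F t) p x = 0) ->
  findim (madjoin N s).
Proof.
move=> fN; elim: s => // t s IH hs.
have [p p0 hp] : exists2 p, p != 0 & forall x, N x -> papp (F t) p x = 0 by apply: hs; rewrite inE eqxx.
apply: (findim_adjoin (p := p)) => //.
- exact: madjoin_subsp.
- by apply: IH => t' ts; apply: hs; rewrite inE ts orbT.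
move=> x; apply: (madjoin_min (P := fun x => papp (F t) p x = 0)) => //.
  exact: (subsp_preim (papp_lin p (lF t)) (@subsp_zero _ _)).
by move=> t' y _ e; rewrite -papp_comm // e lin0.
Qed.

Lemma madjoin_cdim s : findim N -> cdim (madjoin N s).
Proof.
by move=> fN; elim: s => [|t s IH]; [apply: findim_cdim|apply: cdim_adjoin => //; apply: madjoin_subsp].
Qed.

End MultiAdjoin.

(** * Ideals of finitely generated algebras *)

Section Ideals.
Variables (k : fieldType) (R : comAlgType k).
Implicit Types (I J q m : R -> Prop) (p : {poly k}).

Definition idl I := [/\ I 0, forall x y, I x -> I y -> I (x + y) & forall r x, I x -> I (r * x)].

Definition prime_idl q := [/\ idl q, ~ q 1 & forall a b, q (a * b) -> q a \/ q b].

Lemma idl_subsp I : idl I -> subsp I.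
Proof.
by move=> [I0 ID IM]; split=> // c x y Ix Iy; apply: ID => //; rewrite -mulr_algl; apply: IM.
Qed.

Lemma idlMr I x r : idl I -> I x -> I (x * r).
Proof. by move=> [_ _ IM] Ix; rewrite mulrC; apply: IM. Qed.

Lemma idlMl I x r : idl I -> I x -> I (r * x).
Proof. by move=> [_ _ IM] Ix; apply: IM. Qed.

Definition addidl I a x := exists2 y, I y & exists r, x = y + r * a.

Lemma addidl_idl I a : idl I -> idl (addidl I a).
Proof.
move=> [I0 ID IM]; split; first by exists 0 => //; exists 0; rewrite mul0r addr0.
- move=> _ _ [y Iy [r ->]] [z Iz [s ->]]; exists (y + z); first exact: ID.
  by exists (r + s); rewrite mulrDl addrACA.
- move=> t _ [y Iy [r ->]]; exists (t * y); first exact: IM.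
  by exists (t * r); rewrite mulrDr mulrA.
Qed.

Lemma addidl_incl I a x : I x -> addidl I a x.
Proof. by move=> Ix; exists x => //; exists 0; rewrite mul0r addr0. Qed.

Lemma addidl_gen I a : idl I -> addidl I a a.
Proof. by case=> I0 _ _; exists 0 => //; exists 1; rewrite mul1r add0r. Qed.

Lemma prime_prod q (s : nat -> R) n : prime_idl q ->
  (forall i, (i < n)%N -> ~ q (s i)) -> ~ q (\prod_(i < n) s i).
Proof.
move=> [iq q1 qM]; elim: n => [|n IH] hs; first by rewrite big_ord0.
rewrite big_ord_recr /= => /qM[]; last exact: hs.
by apply: IH => i lt; apply: hs; apply: ltnW.
Qed.

Lemma prime_exp q a n : prime_idl q -> ~ q a -> ~ q (a ^+ n).
Proof.
by move=> [iq q1 qM] qa; elim: n => [|n IH]; rewrite ?expr0 // exprS => /qM[].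
Qed.

Definition pev (x : R) p : R := \sum_(i < size p) p`_i *: x ^+ i.

Lemma pev_papp x p w : papp (fun y => x * y) p w = pev x p * w.
Proof.
rewrite /pev mulr_suml; apply: eq_bigr => i _.
rewrite -scalerAl; congr (_ *: _).
by elim: (nat_of_ord i) => [|n IH]; rewrite ?mul1r // iterS IH exprS mulrA.
Qed.

Lemma pev_horner x p : pev x p = (map_poly (in_alg R) p).[x].
Proof.
rewrite (@horner_coef_wide _ (size p)) ?size_map_poly //.
by apply: eq_bigr => i _; rewrite coef_map /= mulr_algl.
Qed.

Lemma pev_mul x p p' : pev x (p * p') = pev x p * pev x p'.
Proof. by rewrite !pev_horner rmorphM hornerM. Qed.

Lemma rmorph_pev (f : {lrmorphism R -> R}) x p : f (pev x p) = pev (f x) p.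
Proof. by rewrite /pev linear_sum; apply: eq_bigr => i _; rewrite linearZ /= rmorphXn. Qed.

(** [R/q] is a domain, where a polynomial of degree [n] has at most [n] roots. To stay in [R], one
    divides [P - P(x0)] exactly by [X - x0], the constant [P(x0)] lying in [q]. *)
Lemma congruent_roots q n (P : {poly R}) (xs : nat -> R) : prime_idl q ->
  size P = n.+1 -> ~ q (lead_coef P) -> (forall i, (i <= n)%N -> q P.[xs i]) ->
  exists i j, [/\ (i < j)%N, (j <= n)%N & q (xs i - xs j)].
Proof.
move=> pq; have [iq q1 qM] := pq; elim: n P => [|n IH] P sP lP rP.
  have [c e] : exists c, P = c%:P by exists P`_0; apply: size1_polyC; rewrite sP.
  by have := rP 0%N (leqnn _); move: lP; rewrite e hornerC lead_coefC.
pose x0 := xs n.+1; pose P' := P - P.[x0]%:P.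
have /factor_theorem [Q PQ] : root P' x0 by rewrite /root !hornerE subrr.
have szC : (size (- P.[x0]%:P)%R < size P)%N.
  by rewrite size_polyN sP (leq_ltn_trans (size_polyC_leq1 _)).
have sP' : size P' = n.+2 by rewrite size_polyDl.
have lP' : lead_coef P' = lead_coef P by rewrite lead_coefDl.
have Q0 : Q != 0 by apply/eqP => Q0; move: sP'; rewrite PQ Q0 mul0r size_poly0.
have sQ : size Q = n.+1.
  by move: sP'; rewrite PQ size_Mmonic ?monicXsubC // size_XsubC addn2 => -[].
have lQ : lead_coef Q = lead_coef P by rewrite -lP' PQ lead_coef_Mmonic ?monicXsubC.
have [[i [le h]]|no] := pselect (exists i, (i <= n)%N /\ q (xs i - x0)).
  by exists i, n.+1.
have [||i [j [ij jn h]]] := IH Q sQ; first by rewrite lQ.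
  move=> i le; have : q (Q.[xs i] * (xs i - x0)).
    have -> : Q.[xs i] * (xs i - x0) = P.[xs i] - P.[x0].
      by rewrite -hornerXsubC -hornerM -PQ /P' hornerD hornerN hornerC.
    by apply: subspB; [apply: idl_subsp|apply: rP; apply: leqW|apply: rP].
  by case/qM => // h; case: no; exists i.
by exists i, j; split=> //; apply: leqW.
Qed.

End Ideals.

Section FinitelyGenerated.
Variables (k : fieldType) (R : comAlgType k) (gs : seq R).
Hypothesis fgen : forall P : R -> Prop,
  (forall c : k, P (c%:A)) -> (forall x y, P x -> P y -> P (x + y)) ->
  (forall x y, P x -> P y -> P (x * y)) -> (forall g, g \in gs -> P g) -> forall r, P r.
Implicit Types (I J q m : R -> Prop) (p : {poly k}).

Let mulop (g : R) (x : R) : R := g * x.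

Let mulop_lin g : lin (mulop g).
Proof. by move=> c x y; rewrite /mulop mulrDr scalerAr. Qed.

Let mulopC g h x : mulop g (mulop h x) = mulop h (mulop g x).
Proof. by rewrite /mulop mulrCA. Qed.

Let one x := spn (fun y : R => y \in [:: 1]) x.

(** [R] arises from the line [k 1] by adjoining the multiplications by its generators, so
    noetherianity and countable dimension come from the results on [madjoin]. *)
Lemma fg_algebra_span r : madjoin mulop one gs r.
Proof.
have s1 : subsp one by apply: spn_subsp.
have sM := madjoin_subsp mulop_lin s1 gs.
suff h : forall x, madjoin mulop one gs x -> madjoin mulop one gs (r * x).
  by rewrite -[r]mulr1; apply: h; apply: madjoin_incl; apply: spn_incl; rewrite inE.
elim/fgen: r => [c x Mx|r s hr hs x Mx|r s hr hs x Mx|g ggs x Mx].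
- by rewrite mulr_algl; apply: subspZ.
- by rewrite mulrDl; apply: subspD => //; [apply: hr|apply: hs].
- by rewrite -mulrA; apply: hr; apply: hs.
- by apply: (madjoin_stable mulop_lin mulopC s1 gs).2 => //; exists g.
Qed.

Lemma fg_algebra_cdim : cdim (fun _ : R => True).
Proof.
have [b hb] := madjoin_cdim mulop_lin (spn_subsp _) gs (findim_spn [:: (1 : R)]).
by exists b => x _; apply: hb; apply: fg_algebra_span.
Qed.

Lemma stable_idl I : stable (ops_of mulop gs) I <-> idl I.
Proof.
split=> [[sI hI]|iI].
  split; [exact: subsp0|by move=> x y; apply: subspD|].
  move=> r; elim/fgen: r => [c x Ix|r s hr hs x Ix|r s hr hs x Ix|g ggs x Ix].
  - by rewrite mulr_algl; apply: subspZ.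
  - by rewrite mulrDl; apply: subspD => //; [apply: hr|apply: hs].
  - by rewrite -mulrA; apply: hr; apply: hs.
  - by apply: (hI (mulop g)) => //; exists g.
by split; [apply: idl_subsp|move=> _ [g _ ->] x Ix; apply: idlMl].
Qed.

Lemma acc_idl : acc (ops_of mulop gs) (fun _ : R => True).
Proof.
have := madjoin_acc mulop_lin mulopC (spn_subsp _) (s := gs) (findim_spn [:: (1 : R)]).
apply: chaincond_sub.
by move=> x _; apply: fg_algebra_span.
Qed.

Lemma idl_chain (C : nat -> R -> Prop) : (forall n, idl (C n)) ->
  (forall n x, C n x -> C n.+1 x) -> exists m : nat, forall n, (m <= n)%N -> forall x, C n x -> C m x.
Proof.
move=> C1 C2; have [|//||m hm] := acc_idl (C := C); first by move=> n; apply/stable_idl.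
  by [].
by exists m => n mn x /(hm n mn).
Qed.

Lemma idl_max (F : (R -> Prop) -> Prop) I0 : (forall I, F I -> idl I) -> F I0 ->
  exists2 I, F I & forall J, F J -> (forall x, I x -> J x) -> forall x, J x -> I x.
Proof.
by move=> hF FI; apply: (acc_max acc_idl _ FI) => I /hF; split=> //; apply/stable_idl.
Qed.

Lemma idl_fg I : idl I -> exists vs : seq R,
  (forall v, v \in vs -> I v) /\
  forall J, idl J -> (forall v, v \in vs -> J v) -> forall x, I x -> J x.
Proof.
move=> iI; have aI : acc (ops_of mulop gs) I by move: acc_idl; apply: chaincond_sub.
have [vs [vsI h]] := acc_fg aI ((stable_idl I).2 iI).
by exists vs; split=> // J /stable_idl sJ hJ x /h; apply.
Qed.

(** Take [m] maximal among the ideals over [q] that avoid the multiplicative set generated by the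
    [s n]. If no [x - c] lies in [m], each of them divides an element of that set modulo [m], and
    Amitsur's trick applies to multiplication by [x]. Algebraicity over [k] is the form in which [m]
    being a maximal ideal is used. *)
Lemma exists_algebraic_idl q (s : nat -> R) : uncountable k -> prime_idl q -> (forall n, ~ q (s n)) ->
  exists m, [/\ prime_idl m, forall x, q x -> m x, forall n, ~ m (s n)
              & forall x, exists2 p, p != 0 & m (pev x p)].
Proof.
move=> unc pq qs; have [iq q1 qM] := pq.
(* A sequence cofinal for divisibility in the multiplicative set: the exponent [n] makes
   [S n * S n'] divide [S (n + n')]. *)
pose S n := (\prod_(i < n) s i) ^+ n.
have S0 : S 0%N = 1 by rewrite /S expr0.
have qS n : ~ q (S n) by apply: (prime_exp pq); apply: (prime_prod pq).
have dS n n' : exists c, S (n + n')%N = c * (S n * S n').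
  have d a b : (a <= b)%N -> exists c, \prod_(i < b) s i = c * \prod_(i < a) s i.
    move=> /subnK <-; elim: (b - a)%N => [|t [c e]]; first by exists 1; rewrite mul1r.
    by exists (s (t + a)%N * c); rewrite addSn big_ord_recr /= e mulrC mulrA.
  have [c hc] := d n (n + n')%N (leq_addr _ _); have [c' hc'] := d n' (n + n')%N (leq_addl _ _).
  exists (c ^+ n * c' ^+ n'); rewrite /S exprD {1}hc hc' !exprMn; ring.
have dsS n : exists c, S n.+1 = c * s n.
  by exists ((\prod_(i < n.+1) s i) ^+ n * \prod_(i < n) s i); rewrite /S exprSr -mulrA big_ord_recr.
pose F I := [/\ idl I, forall x, q x -> I x & forall n, ~ I (S n)].
have [|//|m [im qm mS] hmax] := @idl_max F q; first by move=> I [].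
have mS' a : ~ m a -> exists n y r, m y /\ S n = y + r * a.
  move=> ma; apply: contrapT => no; apply: ma; apply: (hmax (addidl m a)).
  - split; [exact: addidl_idl|by move=> x /qm; apply: addidl_incl|].
    by move=> n [y my [r e]]; apply: no; exists n, y, r.
  - by move=> x; apply: addidl_incl.
  - exact: addidl_gen.
have [m0 mD mM] := im.
have pm : prime_idl m.
  split=> //; first by rewrite -S0; apply: (mS).
  move=> a b mab; have [|ma] := pselect (m a); first by left.
  have [|mb] := pselect (m b); first by right.
  have [n [y [r [my e]]]] := mS' _ ma; have [n' [y' [r' [my' e']]]] := mS' _ mb.
  have [c hc] := dS n n'; case: (mS (n + n')%N); rewrite hc; apply: (mM).
  have -> : S n * S n' = S n' * y + (r * a) * y' + (r * r') * (a * b) by rewrite e e'; ring.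
  by apply: (mD); [apply: (mD); apply: (mM)|apply: (mM)].
exists m; split=> // [n|x].
  by have [c e] := dsS n; move=> ms; apply: (mS n.+1); rewrite e; apply: (mM).
have [[c mc]|no] := pselect (exists c : k, m (x - c%:A)).
  exists ('X - c%:P); first by rewrite polyXsubC_eq0.
  by rewrite pev_horner rmorphB /= map_polyX map_polyC /= hornerXsubC.
have [||||n [p [p0]]] := @countable_dim_algebraic k R (fun y => x * y) _ m S unc fg_algebra_cdim.
- exact: mulop_lin.
- exact: idl_subsp.
- by move=> y; apply: (mM).
- move=> c; have [n [y [r [my e]]]] := mS' _ (fun h => no (ex_intro _ c h)).
  exists r, n; split=> //; have -> : x * r - c *: r - S n = -1 * y.
    by rewrite e -[c *: r]mulr_algl; ring.
  exact: mM.
rewrite pev_papp; case: pm => _ _ pM /pM[mp|/mS //].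
by exists p.
Qed.

(** * Ideals periodic under an automorphism *)

Section Automorphism.
Variables (alpha beta : {lrmorphism R -> R}).
Hypotheses (alphaK : cancel alpha beta) (betaK : cancel beta alpha).

Lemma iter_alphaK n : cancel (iter n alpha) (iter n beta).
Proof. by elim: n => // n IH x; rewrite iterSr iterS alphaK IH. Qed.

Lemma iter_betaK n : cancel (iter n beta) (iter n alpha).
Proof. by elim: n => // n IH x; rewrite iterSr iterS betaK IH. Qed.

Lemma iter_rmorphB (f : {lrmorphism R -> R}) n x y : iter n f (x - y) = iter n f x - iter n f y.
Proof. by elim: n => //= n ->; rewrite rmorphB. Qed.

Lemma iter_rmorphD (f : {lrmorphism R -> R}) n x y : iter n f (x + y) = iter n f x + iter n f y.
Proof. by elim: n => //= n ->; rewrite rmorphD. Qed.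

Lemma iter_rmorphM (f : {lrmorphism R -> R}) n x y : iter n f (x * y) = iter n f x * iter n f y.
Proof. by elim: n => //= n ->; rewrite rmorphM. Qed.

Lemma iter_rmorph0 (f : {lrmorphism R -> R}) n : iter n f 0 = 0.
Proof. by elim: n => //= n ->; rewrite rmorph0. Qed.

Lemma iter_scal (f : {lrmorphism R -> R}) n c : iter n f c%:A = c%:A.
Proof. by elim: n => //= n ->; rewrite linearZ /= rmorph1. Qed.

Lemma iter_pev (f : {lrmorphism R -> R}) n x p : iter n f (pev x p) = pev (iter n f x) p.
Proof. by elim: n => //= n ->; rewrite rmorph_pev. Qed.

Lemma idl_iter (f : {lrmorphism R -> R}) n I : idl I -> idl (fun r => I (iter n f r)).
Proof.
move=> [I0 ID IM]; split; first by rewrite iter_rmorph0.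
- by move=> x y; rewrite iter_rmorphD; apply: ID.
- by move=> r x; rewrite iter_rmorphM; apply: IM.
Qed.

(** The preimages of [I] under the powers [beta^(j n)] increase with [n]; noetherianity stops the
    chain, and [alpha] removes the common power. *)
Lemma idl_beta_stable j I : idl I -> (forall r, I r -> I (iter j beta r)) ->
  forall r, I (iter j beta r) -> I r.
Proof.
move=> iI h r; have [|n x|m hm] := @idl_chain (fun n r => I (iter (j * n) beta r)).
- by move=> n; apply: idl_iter.
- by rewrite mulnS iterD; apply: h.
move=> Ir; have := hm m.+1 (leqnSn m) (iter (j * m) alpha r).
by rewrite iter_alphaK mulnS iterD iter_alphaK; apply.
Qed.

(** [beta^N] induces an injective [k]-endomorphism of [R/q] and maps roots of a polynomial over [k]
    to roots. A generator therefore has two congruent iterates, and injectivity turns the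
    coincidence into a period; the product of the periods serves all generators. *)
Lemma beta_periodic_mod_prime q N : prime_idl q -> (0 < N)%N ->
  (forall r, q r -> q (iter N beta r)) ->
  (forall g, g \in gs -> exists2 p, p != 0 & q (pev g p)) ->
  exists2 N', (0 < N')%N & forall r, q (iter N' beta r - r).
Proof.
move=> pq N0 qN alg; have [iq q1 qM] := pq; have sq := idl_subsp iq.
have stab t r : q r -> q (iter (N * t) beta r).
  by elim: t => [|t IH] qr; rewrite ?muln0 // mulnS iterD; apply: qN; apply: IH.
have unstab t r : q (iter (N * t) beta r) -> q r.
  by apply: idl_beta_stable => //; apply: stab.
have mult t u g : q (iter (N * t) beta g - g) -> q (iter (N * (t * u)) beta g - g).
  move=> h; elim: u => [|u IH]; first by rewrite !muln0 subrr; apply: subsp0.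
  rewrite mulnS mulnDr iterD.
  have -> : iter (N * t) beta (iter (N * (t * u)) beta g) - g =
    iter (N * t) beta (iter (N * (t * u)) beta g - g) + (iter (N * t) beta g - g).
    by rewrite iter_rmorphB addrA subrK.
  by apply: subspD => //; apply: stab.
have per g : g \in gs -> exists2 t, (0 < t)%N & q (iter (N * t) beta g - g).
  move=> /alg [p p0 qp].
  have [||||i [j [ij jn h]]] := @congruent_roots _ _ q (size p).-1 (map_poly (in_alg R) p)
    (fun i => iter (N * i) beta g) => //.
  - by rewrite size_map_poly prednK // lt0n size_poly_eq0.
  - rewrite lead_coef_map /= => h; apply: q1.
    have -> : 1 = (lead_coef p)^-1%:A * (lead_coef p)%:A :> R.
      by rewrite mulr_algl scalerA mulVf ?scale1r // lead_coef_eq0.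
    exact: idlMl.
  - by move=> i _; rewrite -pev_horner -iter_pev; apply: stab.
  exists (j - i)%N; first by rewrite subn_gt0.
  apply: (unstab i); rewrite iter_rmorphB -iterD -mulnDr subnKC; last exact: ltnW.
  by rewrite -opprB; apply: subspN.
have [t t0 ht] : exists2 t, (0 < t)%N & forall g, g \in gs -> q (iter (N * t) beta g - g).
  elim: (gs) per => [|g s IH] per; first by exists 1%N.
  have [t t0 ht] := IH (fun g h => per g (mem_behead (s := _ :: _) h)).
  have [u u0 hu] := per g (mem_head _ _).
  exists (t * u)%N; first by rewrite muln_gt0 t0.
  move=> g'; rewrite inE => /orP[/eqP ->|/ht h]; last exact: mult.
  by rewrite [(t * u)%N]mulnC; apply: mult.
exists (N * t)%N; first by rewrite muln_gt0 N0.
elim/fgen => [c|x y hx hy|x y hx hy|g ggs]; last exact: ht.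
- by rewrite iter_scal subrr; apply: subsp0.
- by rewrite iter_rmorphD opprD addrACA; apply: subspD.
- rewrite iter_rmorphM; set x' := iter _ _ x; set y' := iter _ _ y.
  have -> : x' * y' - x * y = x' * (y' - y) + y * (x' - x) by ring.
  by apply: subspD => //; apply: idlMl.
Qed.

End Automorphism.
End FinitelyGenerated.

(** * Modules over the skew polynomial ring *)

Section SkewModules.
Variables (k : fieldType) (R : comAlgType k) (gs : seq R).
Hypothesis fgen : forall P : R -> Prop,
  (forall c : k, P (c%:A)) -> (forall x y, P x -> P y -> P (x + y)) ->
  (forall x y, P x -> P y -> P (x * y)) -> (forall g, g \in gs -> P g) -> forall r, P r.
Variables (alpha beta : {lrmorphism R -> R}).
Hypotheses (alphaK : cancel alpha beta) (betaK : cancel beta alpha).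

(* [ra r] is right multiplication by [r], [th] right multiplication by theta. *)
Record skewmod (W : lmodType k) (ra : R -> W -> W) (th : W -> W) : Prop := SkewMod {
  ra_lin : forall r, lin (ra r);
  th_lin : lin th;
  raD : forall r s x, ra (r + s) x = ra r x + ra s x;
  raM : forall r s x, ra (r * s) x = ra r (ra s x);
  raC : forall c x, ra c%:A x = c *: x;
  ra_th : forall r x, ra r (th x) = th (ra (alpha r) x) }.

Variables (W : lmodType k) (ra : R -> W -> W) (th : W -> W).
Hypothesis sm : skewmod ra th.
Implicit Types (P U V N : W -> Prop) (x y v w : W) (es : seq W).

Let raL := ra_lin sm.
Let thL := th_lin sm.

Lemma ra1 x : ra 1 x = x.
Proof. by rewrite -[1](scale1r) (raC sm) scale1r. Qed.

Lemma ra0 x : ra 0 x = 0.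
Proof. by rewrite -(scale0r (1 : R)) (raC sm) scale0r. Qed.

Lemma raN r x : ra (- r) x = - ra r x.
Proof. by apply/eqP; rewrite -addr_eq0 -(raD sm) addNr ra0. Qed.

Lemma raB r s x : ra (r - s) x = ra r x - ra s x.
Proof. by rewrite (raD sm) raN. Qed.

Lemma ra_comm r s x : ra r (ra s x) = ra s (ra r x).
Proof. by rewrite -!(raM sm) mulrC. Qed.

Lemma th_ra r x : th (ra r x) = ra (beta r) (th x).
Proof. by rewrite (ra_th sm) betaK. Qed.

Lemma ra_iter_th n r x : ra r (iter n th x) = iter n th (ra (iter n alpha r) x).
Proof. by elim: n r => // n IH r; rewrite iterS (ra_th sm) IH -iterSr. Qed.

Lemma iter_th_ra n r x : iter n th (ra r x) = ra (iter n beta r) (iter n th x).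
Proof. by elim: n => // n IH; rewrite !iterS IH th_ra. Qed.

Lemma ra_pev g p x : ra (pev g p) x = papp (ra g) p x.
Proof.
rewrite /pev /papp; elim/big_ind2 : _ => [||i _]; first by rewrite ra0.
- by move=> r1 y1 r2 y2 <- <-; rewrite (raD sm).
- rewrite -mulr_algl (raM sm) (raC sm); congr (_ *: _).
  by elim: (nat_of_ord i) => [|n IH]; rewrite ?ra1 // exprS (raM sm) IH.
Qed.

Lemma ra_gens P : subsp P -> (forall g x, g \in gs -> P x -> P (ra g x)) ->
  forall r x, P x -> P (ra r x).
Proof.
move=> sP hg r; elim/fgen: r => [c x Px|r s hr hs x Px|r s hr hs x Px|g ggs x Px].
- by rewrite (raC sm); apply: subspZ.
- by rewrite (raD sm); apply: subspD => //; [apply: hr|apply: hs].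
- by rewrite (raM sm); apply: hr; apply: hs.
- exact: hg.
Qed.

Definition ssub P := [/\ subsp P, forall r x, P x -> P (ra r x) & forall x, P x -> P (th x)].

Lemma ssub_subsp P : ssub P -> subsp P. Proof. by case. Qed.

Lemma ssub_iter P n x : ssub P -> P x -> P (iter n th x).
Proof. by case=> _ _ h Px; elim: n => //= n; apply: h. Qed.

Lemma ssub_zero : ssub (fun x => x = 0).
Proof. by split=> [|r x ->|x ->]; [apply: subsp_zero|apply: lin0|apply: lin0]. Qed.

Definition ra_ops (Y : W -> W) := exists r, Y = ra r.
Definition sops := addop th ra_ops.

Lemma stable_ssub P : stable sops P <-> ssub P.
Proof.
split=> [[sP h]|[sP rP tP]].
  by split=> // [r x|x]; apply: h; [left; exists r|right].
by split=> // _ [[r ->]|->]; [apply: rP|apply: tP].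
Qed.

Definition sgen es x := forall P, ssub P -> (forall e, e \in es -> P e) -> P x.

Lemma sgen_ssub es : ssub (sgen es).
Proof.
split; first split.
- by move=> P [[]].
- by move=> c x y hx hy P hP he; case: (hP) => -[_ h] _ _; apply: h; [apply: hx|apply: hy].
- by move=> r x hx P hP he; case: (hP) => _ h _; apply: h; apply: hx.
- by move=> x hx P hP he; case: (hP) => _ _ h; apply: h; apply: hx.
Qed.

Lemma sgen_incl es e : e \in es -> sgen es e.
Proof. by move=> ees P _; apply. Qed.

Lemma adjoin_th_ssub N : subsp N -> (forall r x, N x -> N (ra r x)) -> ssub (adjoin N th).
Proof.
move=> sN rN; split; first exact: adjoin_subsp.
- move=> r x [n d]; exists n; move: d; apply: (adjoin_le_stable (O := ra_ops)).
  + by split=> // _ [s ->]; apply: rN.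
  + by move=> _ [s ->].
  + by move=> _ [s ->]; exists (ra (alpha s)); [exists (alpha s)|move=> y; rewrite (ra_th sm)].
  + by exists r.
- by move=> x; apply: adjoin_op.
Qed.

(** The [R]-submodule generated by [es], in the form to which the results on [madjoin] apply. *)
Let base es := madjoin ra (spn (fun y => y \in es)) gs.

Let base_subsp es : subsp (base es).
Proof. by apply: madjoin_subsp; [apply: raL|apply: spn_subsp]. Qed.

Let base_ra es r x : base es x -> base es (ra r x).
Proof.
apply: ra_gens => // g y ggs; apply: (madjoin_stable raL ra_comm (spn_subsp _) gs).2.
by exists g.
Qed.

Lemma sgen_adjoin es x : sgen es x -> adjoin (base es) th x.
Proof.
apply; first by apply: adjoin_th_ssub => // r y; apply: base_ra.
by move=> e ees; apply: adjoin_incl; apply: madjoin_incl; apply: spn_incl.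
Qed.

(** Hilbert's basis theorem for the generators of [R] over the span of [es], and once more for
    [theta], where [alpha] and [beta] supply the two commutation hypotheses. *)
Lemma sgen_acc es : acc sops (sgen es).
Proof.
have : acc sops (adjoin (base es) th).
  apply: adjoin_acc => //.
  - by split=> // _ [r ->] x; apply: base_ra.
  - by move=> _ [r ->].
  - by move=> _ [r ->]; exists (ra (alpha r)); [exists (alpha r)|move=> y; rewrite (ra_th sm)].
  - by move=> _ [r ->]; exists (ra (beta r)); [exists (beta r)|move=> y; rewrite th_ra].
  have : acc (ops_of ra gs) (base es).
    by apply: madjoin_acc; [apply: raL|apply: ra_comm|apply: spn_subsp|apply: findim_spn].
  apply: chaincond_ops => P [sP rP]; split=> // _ [g ggs ->]; apply: rP; by exists g.
by apply: chaincond_sub => x; apply: sgen_adjoin.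
Qed.

Lemma ssub_fg N : ssub N -> acc sops N ->
  exists es, (forall e, e \in es -> N e) /\ forall x, N x -> sgen es x.
Proof.
move=> sN aN; have [es [eN h]] := acc_fg aN ((stable_ssub N).2 sN).
by exists es; split=> // x /h hx P /stable_ssub sP; apply: hx.
Qed.

Lemma papp_comm_in (X Y : W -> W) p U x : lin Y -> (forall x, U x -> U (X x)) ->
  (forall x, U x -> Y (X x) = X (Y x)) -> U x -> Y (papp X p x) = papp X p (Y x).
Proof.
move=> lY UX YX Ux; rewrite lin_sum //; apply: eq_bigr => i _; rewrite linZ //; congr (_ *: _).
elim: (nat_of_ord i) => //= n IH; rewrite YX ?IH //.
by elim: n {IH} => //= n IH; apply: UX.
Qed.

(** The [R]-module generated by [es] is finite-dimensional, and [p(theta^n)], which commutes with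
    [R], kills it. So [theta] satisfies there the polynomial [p(X^n)], nonzero because [n] is
    positive. *)
Lemma sgen_findim es n p : (0 < n)%N -> p != 0 ->
  (forall g, g \in gs -> exists2 p, p != 0 & forall e, e \in es -> papp (ra g) p e = 0) ->
  (forall r x, sgen es x -> ra r (iter n th x) = iter n th (ra r x)) ->
  (forall e, e \in es -> papp (iter n th) p e = 0) -> findim (sgen es).
Proof.
move=> n0 p0 hg comm hp.
apply: (findim_sub (@sgen_adjoin es)).
have zL : lin (iter n th) by apply: lin_iter.
apply: (findim_adjoin (p := p \Po 'X^n)) => //.
- apply: madjoin_findim; [exact: raL|exact: ra_comm|exact: spn_subsp|exact: findim_spn|].
  move=> g /hg [pg pg0 h]; exists pg => // x hx.
  apply: (hx (fun x => papp (ra g) pg x = 0)) => //.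
  exact: (subsp_preim (papp_lin pg (raL g)) (@subsp_zero _ _)).
- by rewrite comp_poly_eq0 // size_polyXn ltnS.
move=> x bx; rewrite papp_compXn.
pose Q y := sgen es y /\ papp (iter n th) p y = 0.
have sgS := sgen_ssub es; case: (sgS) => sS rS _.
have sQ : subsp Q.
  exact: subsp_cap sS (subsp_preim (papp_lin p zL) (@subsp_zero _ _)).
suff [] : Q x by [].
apply: (madjoin_min sQ _ _ bx) => [y hy|g y _ [hy e]].
  by apply: hy => // e ees; split; [apply: sgen_incl|apply: hp].
split; first exact: rS.
rewrite -(@papp_comm_in _ _ _ (sgen es)) ?e ?lin0 //.
- by move=> z; apply: ssub_iter.
- by move=> z; apply: comm.
Qed.

(** A maximal member among the annihilators of nonzero vectors of [V] is prime; it exists because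
    [R] is noetherian. *)
Lemma exists_prime_ann V v : (forall r x, V x -> V (ra r x)) -> V v -> v != 0 ->
  exists w, [/\ V w, w != 0 & prime_idl (fun r => ra r w = 0)].
Proof.
move=> rV Vv v0.
have iann w : idl (fun r => ra r w = 0).
  split; [exact: ra0|by move=> r s h1 h2; rewrite (raD sm) h1 h2 addr0|].
  by move=> r s h; rewrite (raM sm) h; apply: lin0.
pose F I := exists w, [/\ V w, w != 0 & I = (fun r => ra r w = 0)].
have [||_ [w [Vw w0 ->]] hmax] := @idl_max _ _ gs fgen F (fun r => ra r v = 0).
- by move=> _ [w [_ _ ->]]; apply: iann.
- by exists v.
exists w; split=> //; split=> //; first by rewrite ra1; apply/eqP.
move=> a b; rewrite (raM sm) => ab; have [->|b0] := eqVneq (ra b w) 0; first by right.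
left; apply: (hmax (fun r => ra r (ra b w) = 0)) => //.
  by exists (ra b w); split=> //; apply: rV.
by move=> r h; rewrite ra_comm h; apply: lin0.
Qed.

Lemma sgen1_adjoin w x : sgen [:: w] x -> adjoin (fun y => exists s, y = ra s w) th x.
Proof.
apply=> [|e].
  apply: adjoin_th_ssub.
    split; first by exists 0; rewrite ra0.
    by move=> c _ _ [r ->] [s ->]; exists (c *: r + s); rewrite (raD sm) -mulr_algl (raM sm) (raC sm).
  by move=> r _ [s ->]; exists (r * s); rewrite (raM sm).
rewrite inE => /eqP ->; apply: adjoin_incl; by exists 1; rewrite ra1.
Qed.

(** Killing [w theta^j] modulo [U] passes to [w s theta^j], because [s] can be moved across
    [theta^j] and then commutes with [r]. *)
Lemma adjoin_le_ann U w d x r : ssub U ->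
  adjoin_le (fun y => exists s, y = ra s w) th d x ->
  (forall j, (j < d)%N -> U (ra r (iter j th w))) -> U (ra r x).
Proof.
case=> sU rU tU; elim: d x => [x -> _|d IH x [_ [m' [[s ->] dm' ->]]] h].
  by rewrite lin0; [apply: subsp0|apply: raL].
rewrite (linD _ _ (raL r)); apply: subspD => //; last first.
  by apply: IH => // j jd; apply: h; apply: leqW.
by rewrite iter_th_ra ra_comm; apply: rU; apply: h.
Qed.

(* If [w theta^n] lies in [U + w theta^(n+1) S], a product of ring elements, one for each
   term of the expression, contradicts primality unless the annihilator is periodic. *)
Lemma ann_periodic U w n : ssub U -> (forall x, U (th x) -> U x) ->
  prime_idl (fun r => U (ra r w)) ->
  (exists2 u, U u & sgen [:: iter n.+1 th w] (iter n th w - u)) ->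
  exists2 j, (0 < j)%N & forall r, U (ra r w) -> U (ra (iter j beta r) w).
Proof.
move=> sU refl pA [u Uu /sgen1_adjoin [d hd]].
have [sU' rU tU] := sU; have [iA A1 AM] := pA.
have reflI m x : U (iter m th x) <-> U x.
  by split; [elim: m => //= m IH /refl|apply: ssub_iter].
(* By [ra_iter_th] and [reflI], [r] kills [w theta^m] modulo [U] exactly when [alpha^m r] kills [w].
   So an intersection of [d] shifts of the annihilator of [w] lies in another shift, and primality
   singles out one of the [d]. *)
have key r : (forall j, (j < d)%N -> U (ra (iter (j + n.+1) alpha r) w)) -> U (ra (iter n alpha r) w).
  move=> h; apply/(reflI n); rewrite -ra_iter_th -[iter n th w](subrK u) (linD _ _ (raL r)).
  apply: subspD => //; last exact: rU.
  apply: (adjoin_le_ann (w := iter n.+1 th w) (d := d)) => // j jd.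
  by rewrite -iterD ra_iter_th; apply/reflI; apply: h.
have [[j jd h]|no] := pselect (exists2 j, (j < d)%N &
    forall r, U (ra (iter (j + n.+1) alpha r) w) -> U (ra (iter n alpha r) w)).
  exists j.+1 => // r Ur; have := h (iter (j + n.+1) beta r).
  rewrite (iter_betaK betaK) => /(_ Ur).
  by rewrite addnS addnC -addnS iterD (iter_betaK betaK).
have /choice [rs hrs] j : exists r, (j < d)%N ->
    U (ra (iter (j + n.+1) alpha r) w) /\ ~ U (ra (iter n alpha r) w).
  have [jd|] := boolP (j < d)%N; last by exists 0.
  apply: contrapT => h; apply: no; exists j => // r Ur; apply: contrapT => nU.
  by apply: h; exists r.
have iter_prod m t : iter m alpha (\prod_(i < t) rs i) = \prod_(i < t) iter m alpha (rs i).
  by elim: m => //= m ->; rewrite rmorph_prod.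
have : ~ U (ra (iter n alpha (\prod_(i < d) rs i)) w).
  rewrite iter_prod; apply: (@prime_prod _ _ (fun r => U (ra r w)) (fun i => iter n alpha (rs i)) d pA).
  by move=> i /hrs [].
case; apply: key => j jd; rewrite iter_prod (bigD1 (Ordinal jd)) //=.
rewrite mulrC (raM sm); apply: rU; by case: (hrs j jd).
Qed.

(** Each vector has more iterates than the dimension allows, hence a polynomial of its own; the
    product over a spanning family kills [V]. *)
Lemma findim_algebraic V (X : W -> W) : lin X -> subsp V -> (forall x, V x -> V (X x)) ->
  findim V -> exists2 p, p != 0 & forall v, V v -> papp X p v = 0.
Proof.
move=> lX sV VX fV; have [vs [vsV hvs]] := findim_basis sV fV.
have one v : V v -> exists2 p, p != 0 & papp X p v = 0.
  move=> Vv; have [||l [[i0 l0] rel]] := @dependent_family _ _ vs (size vs).+1 (fun i => iter i X v).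
  - exact: ltnSn.
  - by move=> i; apply: hvs; elim: (nat_of_ord i) => //= n; apply: VX.
  exists (\poly_(i < (size vs).+1) l (inord i)).
    apply/eqP => e; case/eqP: l0; have := congr1 (fun q : {poly k} => q`_i0) e.
    by rewrite coef_poly ltn_ord inord_val coef0.
  rewrite (@papp_wide _ _ _ _ (size vs).+1) ?size_poly // -[RHS]rel.
  by apply: eq_bigr => i _; rewrite coef_poly ltn_ord inord_val.
have [p p0 hp] : exists2 p, p != 0 & forall v, v \in vs -> papp X p v = 0.
  elim: vs vsV {hvs} => [|v vs IH] vsV; first by exists 1; rewrite ?oner_neq0.
  have [q q0 hq] := IH (fun w h => vsV w (mem_behead (s := _ :: _) h)).
  have [q' q'0 hq'] := one _ (vsV v (mem_head _ _)).
  exists (q * q'); first by rewrite mulf_neq0.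
  move=> w; rewrite inE => /orP[/eqP ->|/hq h]; first by rewrite papp_mul // hq' lin0 //; apply: papp_lin.
  by rewrite mulrC papp_mul // h lin0 //; apply: papp_lin.
exists p => // v /hvs hv; apply: (hv (fun v => papp X p v = 0)) => //.
exact: (subsp_preim (papp_lin p lX) (@subsp_zero _ _)).
Qed.

(** * Essential extensions of finite-dimensional simples *)

(** Says at once that [V] is simple and that the ambient [W] is an essential extension of it. *)
Definition least_ssub V := [/\ ssub V, exists2 v, V v & v != 0
  & forall P, ssub P -> (exists2 x, P x & x != 0) -> forall v, V v -> P v].

Lemma fitting V N (X : W -> W) : least_ssub V -> acc sops N -> lin X ->
  (forall v, V v -> X v = 0) -> (forall n, ssub (fun x => N x /\ iter n X x = 0)) ->
  (forall n, ssub (fun y => exists2 x, N x & y = iter n X x)) ->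
  exists n, forall x, N x -> iter n X x = 0.
Proof.
move=> [_ [v0 Vv0 nv0] ess] aN lX XV sK sI.
have [||n x [Nx e]|m hm] := aN (fun n x => N x /\ iter n X x = 0).
- by move=> n; apply/stable_ssub.
- by move=> n x [].
- by split=> //=; rewrite e lin0.
exists m => x Nx; apply/eqP/negPn/negP => nz.
have [x0 Nx0 e] : exists2 x, N x & v0 = iter m X x.
  by apply: (ess _ (sI m)) => //; exists (iter m X x) => //; exists x.
have [] := (hm m.+1 (leqnSn m) x0).1; last by rewrite -e => _ /eqP; rewrite (negPf nv0).
by split=> //=; rewrite -e; apply: XV.
Qed.

Lemma fitting_comm V N (X : W -> W) : least_ssub V -> ssub N -> acc sops N -> lin X ->
  (forall v, V v -> X v = 0) -> (forall x, N x -> N (X x)) ->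
  (forall r x, N x -> ra r (X x) = X (ra r x)) -> (forall x, N x -> th (X x) = X (th x)) ->
  exists n, forall x, N x -> iter n X x = 0.
Proof.
move=> lV sN aN lX XV NX Xr Xt; have [sN' rN tN] := sN.
have Ni n x : N x -> N (iter n X x) by move=> Nx; elim: n => //= n; apply: NX.
have ir n r x : N x -> ra r (iter n X x) = iter n X (ra r x).
  by move=> Nx; elim: n => //= n IH; rewrite Xr ?IH //; apply: Ni.
have it n x : N x -> th (iter n X x) = iter n X (th x).
  by move=> Nx; elim: n => //= n IH; rewrite Xt ?IH //; apply: Ni.
have iL n : lin (iter n X) by apply: lin_iter.
apply: (fitting lV) => // n.
- split; first exact: subsp_cap sN' (subsp_preim (iL n) (@subsp_zero _ _)).
  + by move=> r x [Nx e]; split; [apply: rN|rewrite -ir // e; apply: lin0].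
  + by move=> x [Nx e]; split; [apply: tN|rewrite -it // e; apply: lin0].
- split; first exact: subsp_im (iL n) sN'.
  + by move=> r _ [x Nx ->]; exists (ra r x); [apply: rN|rewrite ir].
  + by move=> _ [x Nx ->]; exists (th x); [apply: tN|rewrite it].
Qed.

(** The submodule [N I^n], where [N] is generated by [es]. *)
Fixpoint idl_pow es (I : R -> Prop) n : W -> Prop :=
  if n is n'.+1 then spn (fun y => exists b x, [/\ I b, idl_pow es I n' x & y = ra b x])
  else sgen es.

Lemma idl_pow_ssub es I n : idl I -> (forall r, I r -> I (beta r)) -> ssub (idl_pow es I n).
Proof.
move=> iI Ib; elim: n => [|n [s r t]] /=; first exact: sgen_ssub.
split; first exact: spn_subsp.
- move=> a x hx; apply: (hx (fun x => spn _ (ra a x))).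
    by apply: subsp_preim; [apply: raL|apply: spn_subsp].
  move=> _ [b [y [Ib' hy ->]]]; apply: spn_incl; exists b, (ra a y); split=> //; first exact: r.
  exact: ra_comm.
- move=> x hx; apply: (hx (fun x => spn _ (th x))).
    by apply: subsp_preim; [apply: thL|apply: spn_subsp].
  move=> _ [b [y [Ib' hy ->]]]; apply: spn_incl; exists (beta b), (th y).
  by split; [apply: Ib|apply: t|apply: th_ra].
Qed.

(* Weak Artin-Rees property, from the noetherianity of the Rees module
   [sum_n M I^n t^n], whose elements are coded as sequences. *)
Lemma weak_artin_rees es I V : idl I -> (forall r, I r -> I (alpha r)) ->
  (forall r, I r -> I (beta r)) -> ssub V -> (exists2 v, V v & v != 0) ->
  (forall b v, I b -> V v -> ra b v = 0) ->
  exists n, ~ forall v, V v -> idl_pow es I n v.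
Proof.
move=> iI Ia Ib sV [v0 Vv0 nv0] kV; apply: contrapT => no.
have {no} all n v : V v -> idl_pow es I n v.
  by move=> Vv; apply: contrapT => h; apply: no; exists n => h'; apply: h; apply: h'.
have [sV' rV tV] := sV.
have [as_ [asI Igen]] := idl_fg fgen iI.
pose W' : lmodType k := nat -> W.
pose ra' r : W' -> W' := fun u i => ra r (u i).
pose th' : W' -> W' := fun u i => th (u i).
(* [sh b] is multiplication by [b t] in the Rees algebra, and [del n x] is the homogeneous element
   [x t^n]. *)
pose sh b : W' -> W' := fun u i => if i is j.+1 then ra b (u j) else 0.
pose del n x : W' := fun i => if i == n then x else 0.
have ra'L r : lin (ra' r) by move=> c u v; apply: funext => i; apply: raL.
have th'L : lin th' by move=> c u v; apply: funext => i; apply: thL.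
have shL b : lin (sh b).
  move=> c u v; apply: funext => -[|i]; last exact: raL.
  by rewrite /sh /= -[RHS]/(c *: 0 + 0) scaler0 addr0.
have delL n : forall c x y, del n (c *: x + y) = c *: del n x + del n y.
  move=> c x y; apply: funext => i; rewrite -[RHS]/(c *: del n x i + del n y i) /del.
  by case: eqP => // _; rewrite scaler0 addr0.
pose F (t : R + R) : W' -> W' := match t with inl g => ra' g | inr b => sh b end.
have FL t : lin (F t) by case: t.
have FC s t u : F s (F t u) = F t (F s u).
  by case: s t => [g|b] [h|c]; apply: funext => i /=; [exact: ra_comm|case: i => [|i]..] => /=;
    rewrite /ra' /sh ?lin0 //; try exact: ra_comm; case: i => [|i]; rewrite ?lin0 //; exact: ra_comm.
pose s : seq (R + R) := map inl gs ++ map inr as_.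
pose M0 := spn (fun u : W' => u \in map (del 0%N) es).
have sM0 : subsp M0 by apply: spn_subsp.
pose MR := madjoin F M0 s.
have sMR : subsp MR by apply: madjoin_subsp.
pose O (Y : W' -> W') := (exists r, Y = ra' r) \/ (exists2 b, I b & Y = sh b).
have stO (P : W' -> Prop) : stable (ops_of F s) P -> stable O P.
  move=> [sP hP]; have raP : forall r u, P u -> P (ra' r u).
    move=> r; elim/fgen: r => [c u Pu|r t hr ht u Pu|r t hr ht u Pu|g ggs u Pu].
    + have -> : ra' c%:A u = c *: u by apply: funext => i; apply: (raC sm).
      exact: subspZ.
    + have -> : ra' (r + t) u = ra' r u + ra' t u by apply: funext => i; apply: (raD sm).
      by apply: subspD => //; [apply: hr|apply: ht].
    + have -> : ra' (r * t) u = ra' r (ra' t u) by apply: funext => i; apply: (raM sm).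
      by apply: hr; apply: ht.
    + by apply: (hP (ra' g)) => //; exists (inl g) => //; rewrite mem_cat map_f.
  split=> // _ [[r ->]|[b Ib' ->]]; first exact: raP.
  move: b Ib'; apply: Igen; last first.
    move=> a aas; apply: hP; exists (inr a) => //.
    by rewrite mem_cat [X in _ || X]map_f ?orbT.
  split.
  + move=> u _; have -> : sh 0 u = 0 by apply: funext => -[|i] //=; apply: ra0.
    exact: subsp0.
  + move=> b c hb hc u Pu; have -> : sh (b + c) u = sh b u + sh c u.
      apply: funext => -[|i]; last exact: (raD sm).
      by rewrite -[RHS]/(0 + 0) addr0.
    by apply: subspD => //; [apply: hb|apply: hc].
  + move=> r b hb u Pu; have -> : sh (r * b) u = ra' r (sh b u).
      by apply: funext => -[|i] /=; rewrite /ra' /sh ?lin0 ?(raM sm).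
    by apply: raP; apply: hb.
have MRO : stable O MR by apply: stO; apply: madjoin_stable.
have accMR : acc O MR.
  have : acc (ops_of F s) MR by apply: madjoin_acc => //; apply: findim_spn.
  apply: chaincond_ops => P [sP hP]; split=> // _ [[g|b] ts ->]; apply: hP.
    by left; exists g.
  right; exists b => //; apply: asI; move: ts; rewrite mem_cat => /orP[/mapP[] //|].
  by case/mapP => c cas [->].
pose MS := adjoin MR th'.
have OL Y : O Y -> lin Y by case=> [[r ->]|[b _ ->]].
have commr Y : O Y -> exists2 Y', O Y' & forall u, Y (th' u) = th' (Y' u).
  case=> [[r ->]|[b Ib' ->]].
    exists (ra' (alpha r)); first by left; exists (alpha r).
    by move=> u; apply: funext => i; apply: (ra_th sm).
  exists (sh (alpha b)); first by right; exists (alpha b) => //; apply: Ia.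
  move=> u; apply: funext => -[|i]; first by rewrite /th' /= lin0.
  exact: (ra_th sm).
have comml Y : O Y -> exists2 Y', O Y' & forall u, Y' (th' u) = th' (Y u).
  case=> [[r ->]|[b Ib' ->]].
    exists (ra' (beta r)); first by left; exists (beta r).
    by move=> u; apply: funext => i; rewrite /th' /ra' th_ra.
  exists (sh (beta b)); first by right; exists (beta b) => //; apply: Ib.
  move=> u; apply: funext => -[|i]; first by rewrite /th' /= lin0.
  by rewrite /th' /sh th_ra.
have accMS : acc (addop th' O) MS by apply: adjoin_acc.
have [sMS hMS] : stable (addop th' O) MS by apply: adjoin_stable.
have delMS n x : idl_pow es I n x -> MS (del n x).
  have sdel m : subsp (fun x => MS (del m x)).
    split=> [|c y z hy hz].
      have -> : del m 0 = 0 by apply: funext => i; rewrite /del; case: ifP.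
      exact: subsp0.
    by rewrite delL; apply: sMS.2.
  elim: n x => [|n IH] x hx.
    apply: (hx (fun x => MS (del 0%N x))); first split=> //.
    - move=> r y hy; have -> : del 0%N (ra r y) = ra' r (del 0%N y).
        by apply: funext => i; rewrite /del /ra'; case: ifP => // _; rewrite lin0.
      by apply: hMS => //; left; left; exists r.
    - move=> y hy; have -> : del 0%N (th y) = th' (del 0%N y).
        by apply: funext => i; rewrite /del /th'; case: ifP => // _; rewrite lin0.
      by apply: hMS => //; right.
    - move=> e ees; apply: adjoin_incl; apply: madjoin_incl; apply: spn_incl.
      exact: map_f.
  apply: (hx (fun x => MS (del n.+1 x))) => // _ [b [y [Ib' /IH hy ->]]].
  have -> : del n.+1 (ra b y) = sh b (del n y).
    by apply: funext => -[|i] //; rewrite /del /sh eqSS; case: ifP => // _; rewrite lin0.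
  by apply: hMS => //; left; right; exists b.
(* [C j] is [V + V t + ... + V t^j], stable under the shifts because [I] kills [V]. If [V] lay in
   every [N I^n], these would form a strictly ascending chain in the noetherian Rees module. *)
pose C j (u : W') := (forall i, V (u i)) /\ forall i, (j < i)%N -> u i = 0.
have [||j u [h1 h2]|m hm] := accMS C.
- move=> j; split; first split.
  + by split=> // i; apply: subsp0.
  + move=> c u v [hu ku] [hv kv]; split=> i; first by apply: sV'.2.
    by move=> ji; rewrite -[LHS]/(c *: u i + v i) ku // kv // scaler0 addr0.
  + move=> Y OY u [hu ku]; case: OY => [[[r ->]|[b Ib' ->]]|->].
    * by split=> i; [apply: rV|move=> ji; rewrite /ra' ku // lin0].
    * split=> -[|i] //=; try exact: subsp0; try by rewrite /sh kV //; apply: subsp0.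
    * by split=> i; [apply: tV|move=> ji; rewrite /th' ku // lin0].
- move=> j u [hu ku].
  have -> : u = \sum_(i < j.+1) del i (u i).
    apply: funext => i; rewrite fct_sumE.
    have [ij|ij] := ltnP i j.+1; last first.
      rewrite ku // big1 // => l _; rewrite /del; case: eqP => // e.
      by move: ij; rewrite e leqNgt ltn_ord.
    rewrite (bigD1 (Ordinal ij)) //= big1 ?addr0; first by rewrite /del eqxx.
    by move=> l li; rewrite /del; case: eqP => // e; case/eqP: li; apply: val_inj.
  by apply: subsp_sum => // i _; apply: delMS; apply: all.
- by split=> // i /ltnW; apply: h2.
have [_ /(_ m.+1 (ltnSn m))] : C m (del m.+1 v0).
  apply/(hm m.+1 (leqnSn m)); split=> i.
    by rewrite /del; case: ifP => // _; apply: subsp0.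
  by rewrite /del; case: eqP => // ->; rewrite ltnn.
by rewrite /del eqxx => e; rewrite e eqxx in nv0.
Qed.

Lemma findim_joint_ker (T : eqType) (F : T -> W -> W) (s : seq T) N :
  (forall t, lin (F t)) -> subsp N ->
  (forall t, t \in s -> findim (fun y => exists2 x, N x & y = F t x)) ->
  findim (fun x => N x /\ forall t, t \in s -> F t x = 0) -> findim N.
Proof.
move=> FL; elim: s N => [|t s IH] N sN hI hK.
  by apply: findim_sub hK => x Nx; split.
apply: (findim_ker_im (FL t) sN); first by apply: hI; rewrite inE eqxx.
apply: IH.
- exact: subsp_cap sN (subsp_preim (FL t) (@subsp_zero _ _)).
- move=> t' ts; apply: findim_sub (hI t' _); last by rewrite inE ts orbT.
  by move=> _ [x [Nx _] ->]; exists x.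
- apply: findim_sub hK => x [[Nx e] h]; split=> // t'; rewrite inE => /orP[/eqP ->|] //.
  exact: h.
Qed.

(** The vectors killed by [I^n]. *)
Fixpoint idl_tors (I : R -> Prop) n : W -> Prop :=
  if n is n'.+1 then fun x => forall b, I b -> idl_tors I n' (ra b x) else fun x => x = 0.

Lemma idl_tors_subsp I n : subsp (idl_tors I n).
Proof.
elim: n => [|n IH] /=; first exact: subsp_zero.
split=> [b Ib|c x y hx hy b Ib]; first by rewrite lin0; [apply: subsp0|apply: raL].
by rewrite raL; apply: IH.2; [apply: hx|apply: hy].
Qed.

Lemma idl_pow_tors es I n m : (m <= n)%N -> (forall x, idl_pow es I n x -> x = 0) ->
  forall x, idl_pow es I (n - m) x -> idl_tors I m x.
Proof.
move=> mn h; elim: m mn => [|m IH] mn x; first by rewrite subn0; apply: h.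
move=> hx b Ib /=; apply: IH; first exact: ltnW.
by rewrite -subnSK //; apply: spn_incl; exists b, x.
Qed.

(** The finitely many generators of [I] map vectors killed by [I^(n+1)] to vectors killed by [I^n],
    and their common kernel consists of the vectors killed by [I]. *)
Lemma idl_tors_findim I n N : idl I -> ssub N -> findim (fun x => N x /\ idl_tors I 1 x) ->
  findim (fun x => N x /\ idl_tors I n x).
Proof.
move=> iI [sN rN tN] h1; have [as_ [asI Igen]] := idl_fg fgen iI.
elim: n => [|n IH]; first by apply: findim_sub (@findim_zero _ _) => x [].
apply: (@findim_joint_ker _ ra as_) => //.
- exact: subsp_cap sN (idl_tors_subsp I n.+1).
- move=> a aas; apply: findim_sub IH => _ [x [Nx hx] ->].
  by split; [apply: rN|apply: hx; apply: asI].
- apply: findim_sub h1 => x [[Nx _] h]; split=> // b Ib' /=; move: b Ib'; apply: Igen => //.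
  split; [exact: ra0 x|by move=> r s e1 e2; rewrite (raD sm) e1 e2 addr0|].
  by move=> r s e; rewrite (raM sm) e lin0.
Qed.

Lemma least_ssub_gens_alg V g : least_ssub V -> findim V ->
  exists2 p, p != 0 & forall v, V v -> papp (ra g) p v = 0.
Proof. by move=> [[sV rV tV] _ _] fV; apply: findim_algebraic => // x; apply: rV. Qed.

Lemma findim_extension_torsion V es : least_ssub V -> findim V ->
  (forall v, V v -> th v = 0) -> findim (sgen es).
Proof.
move=> lV fV tV0; have [sN rN tN] := sgen_ssub es; set N := sgen es in sN rN tN *.
have aN : acc sops N := @sgen_acc es.
have iL n : lin (iter n th) by apply: lin_iter.
have [n hn] : exists n, forall x, N x -> iter n th x = 0.
  apply: (fitting lV) => // n.
  - split; first exact: subsp_cap sN (subsp_preim (iL n) (@subsp_zero _ _)).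
    + by move=> r x [Nx e]; split; [apply: rN|rewrite iter_th_ra e lin0].
    + by move=> x [Nx e]; split; [apply: tN|rewrite -iterSr iterS e lin0].
  - split; first exact: subsp_im (iL n) sN.
    + by move=> r _ [x Nx ->]; exists (ra (iter n alpha r) x); [apply: rN|rewrite ra_iter_th].
    + by move=> _ [x Nx ->]; exists (th x); [apply: tN|rewrite -iterSr].
pose N1 x := N x /\ th x = 0.
have sN1 : ssub N1.
  split; first exact: subsp_cap sN (subsp_preim thL (@subsp_zero _ _)).
  - by move=> r x [Nx e]; split; [apply: rN|rewrite th_ra e lin0].
  - by move=> x [Nx e]; split; [apply: tN|rewrite e lin0].
have aN1 : acc sops N1 by move: aN; apply: chaincond_sub => x [].
have [es1 [esN1 h1]] := ssub_fg sN1 aN1.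
have sg1 x : sgen es1 x -> N1 x by apply.
(* As [theta] vanishes on [N1], a polynomial in a generator of [R] acts there [S]-linearly, and the
   commuting form of Fitting applies. *)
have f1 : findim N1.
  apply: (findim_sub h1); apply: (@sgen_findim es1 1 'X) => //; first by rewrite polyX_eq0.
  - move=> g ggs; have [p p0 hp] := least_ssub_gens_alg g lV fV.
    have XL := papp_lin p (raL g); have [sN1' rN1 tN1] := sN1.
    have XN x : N1 x -> N1 (papp (ra g) p x) by apply: papp_stable => // y; apply: rN1.
    have [m hm] : exists m, forall x, N1 x -> iter m (papp (ra g) p) x = 0.
      apply: (fitting_comm lV) => // [r x _|x Nx]; first by rewrite papp_comm // => y; apply: ra_comm.
      by rewrite (XN x Nx).2 Nx.2 lin0.
    exists (p ^+ m); first by rewrite expf_neq0.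
    by move=> e ees; rewrite papp_exp //; apply: hm; apply: esN1.
  - by move=> r x /sg1 [Nx e] /=; rewrite e lin0 // th_ra e lin0.
  - by move=> e /esN1 [_ h]; rewrite pappX.
suff fn m : findim (fun x => N x /\ iter m th x = 0).
  by apply: findim_sub (fn n) => x Nx; split=> //; apply: hn.
elim: m => [|m IH]; first by apply: findim_sub (@findim_zero _ _) => x [].
apply: (findim_ker_im thL).
- exact: subsp_cap sN (subsp_preim (iL m.+1) (@subsp_zero _ _)).
- by apply: findim_sub IH => _ [x [Nx e] ->]; split; [apply: tN|rewrite -iterSr].
- by apply: findim_sub f1 => x [[Nx _] e].
Qed.

(** The kernel of [theta] and [V theta] are both submodules. A nonzero kernel would contain [V],
    which is excluded, and [V theta], being nonzero, does contain it. *)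
Lemma least_ssub_th_inj V : least_ssub V -> (exists2 v, V v & th v != 0) ->
  (forall x, th x = 0 -> x = 0) /\ forall v, V v -> exists2 w, V w & v = th w.
Proof.
move=> [[sV rV tV] [v0 Vv0 nv0] ess] [v Vv nv]; split=> [x e|].
  apply/eqP/negPn/negP => nx; case/eqP: nv.
  apply: (ess (fun y => th y = 0)) => //; last by exists x.
  split; first exact: subsp_preim thL (@subsp_zero _ _).
  - by move=> r y e'; rewrite th_ra e' lin0.
  - by move=> y e'; rewrite e' lin0.
apply: (ess (fun y => exists2 w, V w & y = th w)); last by exists (th v) => //; exists v.
split; first exact: subsp_im thL sV.
- by move=> r _ [w Vw ->]; exists (ra (alpha r) w); [apply: rV|rewrite (ra_th sm)].
- by move=> _ [w Vw ->]; exists (th w) => //; apply: tV.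
Qed.

(** Simplicity puts [v] into [v theta S], which is the stationarity hypothesis of [ann_periodic] for
    [U = 0] and [n = 0]. *)
Lemma least_ssub_prime_ann V : least_ssub V -> (exists2 v, V v & th v != 0) ->
  exists v, [/\ V v, v != 0, prime_idl (fun r => ra r v = 0) &
    exists2 j, (0 < j)%N & forall r, ra r v = 0 -> ra (iter j beta r) v = 0].
Proof.
move=> lV hth; have [inj _] := least_ssub_th_inj lV hth.
have [[sV rV tV] [v0 Vv0 nv0] ess] := lV.
have [v [Vv nv pq]] := exists_prime_ann rV Vv0 nv0.
exists v; split=> //; apply: (@ann_periodic (fun x => x = 0) v 0%N) => //; first exact: ssub_zero.
exists 0 => //; rewrite subr0; apply: ess => //; first exact: sgen_ssub.
exists (th v); first by apply: sgen_incl; rewrite inE.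
by apply/eqP => /inj /eqP; rewrite (negPf nv).
Qed.

(** The elements [beta^n r - r] form an [alpha]-stable set, so the vectors they kill form a
    submodule, and one nonzero vector of [V] decides. *)
Lemma least_ssub_central_power V v n : least_ssub V -> V v -> v != 0 ->
  (forall r, ra (iter n beta r - r) v = 0) -> forall w r, V w -> ra (iter n beta r - r) w = 0.
Proof.
move=> [_ _ ess] Vv nv h w r Vw.
apply: (ess (fun w => forall r, ra (iter n beta r - r) w = 0)) => //; last by exists v.
split.
- by split=> [s|c x y hx hy s]; [apply: lin0|rewrite raL hx hy scaler0 addr0].
- by move=> s x hx t; rewrite ra_comm hx lin0.
- move=> x hx s; rewrite (ra_th sm) rmorphB /=.
  have -> : alpha (iter n beta s) = iter n beta (alpha s).
    by case: n {h hx} => // n; rewrite iterS betaK iterSr alphaK.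
  by rewrite hx lin0.
Qed.

Lemma findim_extension V es : least_ssub V -> findim V -> findim (sgen es).
Proof.
move=> lV fV.
have [hth|no] := pselect (exists2 v, V v & th v != 0); last first.
  apply: (findim_extension_torsion _ lV fV) => v Vv.
  by apply/eqP/negPn/negP => nv; apply: no; exists v.
have [inj sur] := least_ssub_th_inj lV hth.
have [sV [v0 Vv0 nv0] ess] := lV; have [sV' rV tV] := sV.
have [v [Vv nv pq [j j0 hj]]] := least_ssub_prime_ann lV hth.
have [n n0 hn] : exists2 n, (0 < n)%N & forall r, ra (iter n beta r - r) v = 0.
  apply: (beta_periodic_mod_prime fgen alphaK pq j0 hj) => g ggs.
  have [p p0 hp] := least_ssub_gens_alg g lV fV.
  by exists p => //; rewrite ra_pev; apply: hp.
have {}hn := least_ssub_central_power lV Vv nv hn.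
pose I r := forall w, V w -> ra r w = 0.
have iI : idl I.
  split; first by move=> w _; rewrite ra0.
  - by move=> r s hr hs w Vw; rewrite (raD sm) hr // hs // addr0.
  - by move=> r s hs w Vw; rewrite (raM sm) hs // lin0.
have Ia r : I r -> I (alpha r) by move=> h w Vw; apply: inj; rewrite -(ra_th sm) h //; apply: tV.
have Ib r : I r -> I (beta r) by move=> h w /sur [w' Vw' ->]; rewrite -th_ra h // lin0.
(* Hence [theta^n] commutes with [R] on every vector killed by [I]. *)
have In r : I (iter n alpha r - r).
  move=> w Vw; have := hn w (iter n alpha r) Vw; rewrite (iter_alphaK alphaK) -opprB.
  by rewrite raN => /eqP; rewrite oppr_eq0 => /eqP.
pose N := sgen es; have [sN rN tN] : ssub N by apply: sgen_ssub.
have aN : acc sops N by apply: sgen_acc.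
have [m hm] : exists m, forall x, idl_pow es I m x -> x = 0.
  have [m hm] := @weak_artin_rees es I V iI Ia Ib sV (ex_intro2 _ _ v0 Vv0 nv0) (fun b w h => h w).
  exists m => x hx; apply/eqP/negPn/negP => nx; apply: hm => w.
  by apply: ess; [apply: idl_pow_ssub|exists x].
have Nm x : N x -> idl_tors I m x.
  by move=> Nx; apply: (@idl_pow_tors es I m m) => //; rewrite subnn.
suff f : findim (fun x => N x /\ idl_tors I m x).
  by apply: findim_sub f => x Nx; split=> //; apply: Nm.
have sgN : ssub N by apply: sgen_ssub.
apply: (idl_tors_findim _ iI sgN).
pose N1 x := N x /\ idl_tors I 1 x.
have sN1 : ssub N1.
  split; first exact: subsp_cap sN (idl_tors_subsp I 1).
  - move=> r x [Nx h]; split; [exact: rN|move=> b Ib' /=].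
    by rewrite ra_comm h // lin0.
  - move=> x [Nx h]; split; [exact: tN|move=> b Ib' /=].
    by rewrite (ra_th sm) h ?lin0 //; apply: Ia.
have aN1 : acc sops N1 by move: aN; apply: chaincond_sub => x [].
have [es1 [esN1 h1]] := ssub_fg sN1 aN1.
have sg1 x : sgen es1 x -> N1 x by apply.
have zL : lin (iter n th) by apply: lin_iter.
have zcomm r x : N1 x -> ra r (iter n th x) = iter n th (ra r x).
  move=> [Nx h]; rewrite ra_iter_th; congr (iter n th _); apply/eqP.
  by rewrite -subr_eq0 -raB; apply/eqP; apply: h; apply: In.
have zN1 x : N1 x -> N1 (iter n th x) by apply: ssub_iter.
have [p p0 hp] : exists2 p, p != 0 & forall v, V v -> papp (iter n th) p v = 0.
  by apply: findim_algebraic => // x; apply: ssub_iter.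
have XL := papp_lin p zL.
have [l hl] : exists l, forall x, N1 x -> iter l (papp (iter n th) p) x = 0.
  apply: (fitting_comm lV) => //.
  - by move=> x; apply: papp_stable => //; case: sN1.
  - by move=> r x Nx; apply: (@papp_comm_in _ _ _ N1) => // y; apply: zcomm.
  - by move=> x Nx; apply: papp_comm => // y; rewrite -iterS iterSr.
apply: (findim_sub h1); apply: (@sgen_findim es1 n (p ^+ l)) => //; first by rewrite expf_neq0.
- move=> g ggs; have [pg pg0 hpg] := least_ssub_gens_alg g lV fV.
  exists pg => // e /esN1 [Ne h]; rewrite -ra_pev //; apply: h => w Vw.
  by rewrite ra_pev //; apply: hpg.
- by move=> r x /sg1; apply: zcomm.
- by move=> e /esN1 Ne; rewrite papp_exp //; apply: hl.
Qed.

(** * Simples under the chain condition *)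

Hypothesis unc : uncountable k.

Lemma sgen_cdim es : cdim (sgen es).
Proof.
have [b hb] : cdim (adjoin (base es) th).
  apply: cdim_adjoin => //; apply: madjoin_cdim; [exact: raL|exact: spn_subsp|exact: findim_spn].
by exists b => x /sgen_adjoin; apply: hb.
Qed.

Lemma least_ssub_sgen V v : least_ssub V -> V v -> v != 0 -> forall x, V x <-> sgen [:: v] x.
Proof.
move=> [sV _ ess] Vv nv x; split.
  by apply: ess; [apply: sgen_ssub|exists v => //; apply: sgen_incl; rewrite inE].
by apply=> // e; rewrite inE => /eqP ->.
Qed.

(** Either [z] has an eigenvector, whose eigenspace is then all of [V], or each [z - c] maps [V]
    onto [V] as in Schur's lemma, and the vectors [(z - c)^-1 v] feed Amitsur's trick in the
    countable-dimensional [V]. *)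
Lemma central_algebraic V (z : W -> W) : least_ssub V -> lin z -> (forall x, V x -> V (z x)) ->
  (forall r x, V x -> ra r (z x) = z (ra r x)) -> (forall x, V x -> th (z x) = z (th x)) ->
  exists2 p, p != 0 & forall v, V v -> papp z p v = 0.
Proof.
move=> lV zL Vz zr zt; have [[sV rV tV] [v Vv nv] ess] := lV.
have ker p w : V w -> w != 0 -> papp z p w = 0 -> forall x, V x -> papp z p x = 0.
  move=> Vw nw e x Vx; suff [] : V x /\ papp z p x = 0 by [].
  apply: (ess (fun x => V x /\ papp z p x = 0)) => //; last by exists w.
  split; first exact: subsp_cap sV (subsp_preim (papp_lin p zL) (@subsp_zero _ _)).
  - move=> r y [Vy e']; split; first exact: rV.
    by rewrite -(@papp_comm_in _ _ _ V) // ?e' ?lin0 // => y' Vy'; apply: zr.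
  - by move=> y [Vy e']; split; [apply: tV|rewrite -(@papp_comm_in _ _ _ V) // e' lin0].
have [[c [w [Vw nw e]]]|no] := pselect (exists c w, [/\ V w, w != 0 & z w = c *: w]).
  exists ('X - c%:P); first by rewrite polyXsubC_eq0.
  by apply: (ker _ w) => //; rewrite papp_XsubC e subrr.
have cV : cdim V.
  have [b hb] := sgen_cdim [:: v]; exists b => x /(least_ssub_sgen lV Vv nv); exact: hb.
have [||||n [p [p0 hp]]] := @countable_dim_algebraic k W z V (fun x => x = 0) (fun=> v) unc cV.
- by [].
- exact: subsp_zero.
- by move=> x ->; apply: lin0.
- move=> c; pose Z x := z x - c *: x.
  have ZL : lin Z by move=> a x y; rewrite /Z zL scalerBr !scalerDr !scalerA [c * a]mulrC opprD addrACA.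
  have [y Vy e] : exists2 y, V y & v = Z y.
    apply: (ess (fun x => exists2 y, V y & x = Z y)) => //.
      split; first exact: subsp_im ZL sV.
      + move=> r _ [x Vx ->]; exists (ra r x); first exact: rV.
        by rewrite /Z linB // zr // linZ.
      + move=> _ [x Vx ->]; exists (th x); first exact: tV.
        by rewrite /Z linB // zt // linZ.
    exists (Z v); first by exists v.
    by apply/eqP => /eqP; rewrite subr_eq0 => /eqP e; apply: no; exists c, v.
  by exists y, 0%N; split=> //; rewrite e -/(Z y) subrr.
by exists p => //; apply: (ker p v).
Qed.

Lemma findim_least_torsion V : least_ssub V -> (forall v, V v -> th v = 0) -> findim V.
Proof.
move=> lV t0; have [[sV rV tV] [v Vv nv] ess] := lV.
apply: (findim_sub (fun x => (least_ssub_sgen lV Vv nv x).1)).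
apply: (@sgen_findim _ 1 'X) => //; first by rewrite polyX_eq0.
- move=> g _; have [||||p p0 hp] := @central_algebraic V (ra g) lV.
  + exact: raL.
  + exact: rV.
  + by move=> r x _; apply: ra_comm.
  + by move=> x Vx; rewrite !t0 ?lin0 //; apply: rV.
  by exists p => // e; rewrite inE => /eqP ->; apply: hp.
- move=> r x /(least_ssub_sgen lV Vv nv) Vx /=; rewrite !t0 ?lin0 //; exact: rV.
- by move=> e; rewrite inE => /eqP ->; rewrite pappX /= t0.
Qed.

(** * Simples not killed by [theta], and the generic maximal ideal *)

Section Generic.
Variables (V : W -> Prop) (v : W) (j : nat).
Hypotheses (lV : least_ssub V) (hth : exists2 v, V v & th v != 0).
Hypotheses (Vv : V v) (nv : v != 0).
Let q r := ra r v = 0.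
Hypotheses (pq : prime_idl q) (j0 : (0 < j)%N) (hj : forall r, q r -> q (iter j beta r)).

(** Membership in the sum of the [v theta^i J] over [i < n]. For an ideal [J] these sums exhaust
    [V J], as [V] is the sum of the [v theta^i R]. *)
Definition orbit_sum (J : R -> Prop) n x :=
  exists2 t : nat -> R, (forall i, J (t i)) & x = \sum_(i < n) ra (t i) (iter i th v).

Lemma orbit_sum_exhaust x : V x -> exists n, orbit_sum (fun _ => True) n x.
Proof.
move/(least_ssub_sgen lV Vv nv)/sgen1_adjoin => [n]; elim: n x => [|n IH] x.
  by move=> ->; exists 0%N, (fun=> 0); rewrite ?big_ord0.
case=> _ [m' [[s ->] dm' ->]].
suff [t _ e] : orbit_sum (fun _ => True) n m'.
  exists n.+1, (fun i => if i == n then iter n beta s else t i) => //.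
  rewrite big_ord_recr /= eqxx addrC iter_th_ra e; congr (_ + _).
  by apply: eq_bigr => i _; rewrite ltn_eqF.
elim: n {IH} m' dm' => [|n IH] m'; first by move=> ->; exists (fun=> 0); rewrite ?big_ord0.
case=> _ [m [[s' ->] /IH [t _ ->] ->]].
exists (fun i => if i == n then iter n beta s' else t i) => //.
rewrite big_ord_recr /= eqxx addrC iter_th_ra; congr (_ + _).
by apply: eq_bigr => i _; rewrite ltn_eqF.
Qed.

(** The ideal whose quotient [R/I_n] is the [n]-th layer of the filtration of [V] by the sums of the
    [v theta^i R]. *)
Let I_ n r := orbit_sum (fun _ => True) n (ra r (iter n th v)).

(** The annihilator of [v theta^n] is the image of [q] under [beta^n], and it is contained in [I_n].
    If that lies in [q], noetherianity forces equality of [q] with its image. *)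
Let I_q n : (forall r, I_ n r -> q r) -> forall r, q r -> ra r (iter n th v) = 0.
Proof.
move=> h; have qn r : q r -> q (iter n beta r).
  move=> qr; apply: h; exists (fun=> 0) => //.
  rewrite ra_iter_th (iter_betaK betaK) qr lin0; last exact: lin_iter.
  by rewrite big1 // => i _; apply: ra0.
move=> r qr; rewrite ra_iter_th.
have -> : ra (iter n alpha r) v = 0; last by apply: lin0; apply: lin_iter.
by apply: (idl_beta_stable fgen alphaK _ qn); [case: pq|rewrite (iter_alphaK alphaK)].
Qed.

(* Away from countably many elements, [V] is locally free over [R / ann v] with [v] in a basis. *)
Lemma exists_generic_max : exists m, [/\ prime_idl m, forall r, q r -> m r,
    forall g, exists2 p, p != 0 & m (pev g p)
  & forall n r, ~ m r -> ~ orbit_sum m n (ra r v)].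
Proof.
(* One element to avoid per layer: it is taken in [I_n] when [I_n] is not inside [q], and is 1
   otherwise. *)
have /choice [f hf] n : exists f, ~ q f /\ ((exists2 r, I_ n r & ~ q r) -> I_ n f).
  have [[r Ir qr]|no] := pselect (exists2 r, I_ n r & ~ q r); first by exists r.
  by exists 1; split; [case: pq|].
have [m [pm qm fm alg]] := exists_algebraic_idl fgen unc pq (fun n => (hf n).1).
have [[m0 mD mM] m1 mP] := pm; have sm' : subsp m by apply: idl_subsp; case: pm.
exists m; split=> //; case=> [|n] r.
  by move=> mr [t _]; rewrite big_ord0 => /qm.
elim: n r => [|n IH] r mr [t mt].
  rewrite big_ord1 /= => e; apply: mr; rewrite -[r](subrK (t 0%N)); apply: mD => //.
  by apply: qm; rewrite /q raB e subrr.
rewrite big_ord_recr /=; set N := n.+1 => e.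
(* The top coefficient lies in [I_N]. If [I_N] is inside [q], it kills [v theta^N] and the top term
   drops out; otherwise multiplication by [f N], which is outside [m], rewrites the top term through
   the lower ones with coefficients still in [m]. *)
have IN : I_ N (t N).
  exists (fun i => (if i == 0%N then r else 0) - t i) => //.
  apply: (addrI (\sum_(i < N) ra (t i) (iter i th v))); rewrite -e -big_split /=.
  under [RHS]eq_bigr => i _ do rewrite -(raD sm) addrC subrK.
  by rewrite big_ord_recl big1 ?addr0 // => i _; rewrite ra0.
have [ex|no] := pselect (exists2 r, I_ N r & ~ q r); last first.
  apply: (IH r mr); exists t => //; rewrite e (I_q (n := N)) ?addr0 //.
    by move=> s Is; apply: contrapT => qs; apply: no; exists s.
  by apply: contrapT => qs; apply: no; exists (t N).
have [u _ eu] := (hf N).2 ex.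
apply: (IH (f N * r)); first by move=> /mP[/fm|].
exists (fun i => f N * t i + t N * u i) => [i|]; first by apply: (mD); [apply: (mM)|rewrite mulrC; apply: (mM)].
rewrite (raM sm) e (linD _ _ (raL _)) lin_sum // [ra (f N) (ra _ _)]ra_comm eu lin_sum // -big_split.
by apply: eq_bigr => i _; rewrite (raD sm) !(raM sm).
Qed.

Hypothesis artinian : forall es, chaincond false sops (sgen es).
Hypothesis extend : forall f, ~ q f -> exists2 e, forall r, q r -> ra r e = 0 & ra f e = v.

(** What becomes stable under [beta^j] is not [m] but a prime lying between [f] and [m], so the
    period depends on [f] and only the orbit of [f] is controlled. For [f] in [q] the period of [q]
    serves. *)
Lemma generic_max_periodic m f : prime_idl m -> (forall r, q r -> m r) ->
  (forall n r, ~ m r -> ~ orbit_sum m n (ra r v)) -> m f ->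
  exists2 j, (0 < j)%N & forall i, m (iter (j * i) beta f).
Proof.
move=> pm qm gen mf; have [im m1 mP] := pm.
have pow (A : R -> Prop) l : (forall r, A r -> A (iter l beta r)) -> A f ->
    forall i, A (iter (l * i) beta f).
  by move=> h Af; elim=> [|i IH]; rewrite ?muln0 // mulnS iterD; apply: h.
have [qf|qf] := pselect (q f).
  by exists j => // i; apply: qm; apply: (pow q).
have [inj sur] := least_ssub_th_inj lV hth.
have [sV _ ess] := lV; have [sV' rV tV] := sV.
have [e qe fe] := extend qf.
pose ann w r := V (ra r w).
have iann w : idl (ann w).
  split; first by rewrite /ann ra0; apply: subsp0.
  - by move=> r s; rewrite /ann (raD sm); apply: subspD.
  - by move=> r s; rewrite /ann (raM sm); apply: rV.
have annM r w s : ann w s -> ann (ra r w) s by move=> h; rewrite /ann ra_comm; apply: rV.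
pose F A := (forall r, A r -> m r) /\ exists r, A = ann (ra r e).
have [||A [Am [r0 eA]] hmax] := @idl_max _ _ gs fgen F (ann (ra 1 e)).
- by move=> _ [_ [r ->]]; apply: iann.
- split; last by exists 1.
  (* If [e r] is in [V] with [r] outside [m], then [v r = (e r) f] is in [V m], against the choice
     of [m]. *)
  rewrite ra1 => r Vr; apply: contrapT => mr.
  have [n [t _ et]] := orbit_sum_exhaust Vr; apply: (gen n r mr).
  exists (fun i => f * t i) => [i|]; first exact: idlMr.
  rewrite -{1}fe ra_comm et lin_sum //.
  by apply: eq_bigr => i _; rewrite (raM sm).
set w := ra r0 e in eA; rewrite {A}eA in Am hmax.
have inF r s : (forall t, ann (ra r w) t -> m t) -> ann (ra r w) s -> ann w s.
  move=> h; apply: (hmax (ann (ra r w))); last by move=> x; apply: annM.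
  by split=> //; exists (r * r0); rewrite (raM sm).
(* Maximality is available only among annihilators inside [m]. If that of [w a] contains some [x]
   outside [m], the annihilator of [w x] is again inside [m] by primality of [m], and it contains
   [a]. *)
have pA : prime_idl (ann w).
  split=> // [/Am //|a b ab].
  have [|na] := pselect (ann w a); first by left.
  right; have ba : ann (ra a w) b by rewrite /ann -(raM sm) mulrC.
  apply: (inF a) => // x xa; apply: contrapT => mx; apply: na.
  apply: (inF x); last by rewrite /ann ra_comm.
  move=> y; rewrite /ann -(raM sm) => /Am /mP[] //.
have Af : ann w f by rewrite /ann ra_comm fe; apply: rV.
have refl x : V (th x) -> V x.
  case/sur => w' Vw' ew; suff -> : x = w' by [].
  by apply/eqP; rewrite -subr_eq0; apply/eqP; apply: inj; rewrite linB // ew subrr.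
pose C n x := exists2 u, V u & sgen [:: iter n th w] (x - u).
have sC n : ssub (C n).
  have [sS rS tS] := sgen_ssub [:: iter n th w]; split; first split.
  - by exists 0; rewrite ?subr0; apply: subsp0.
  - move=> c x y [u Vu hu] [u' Vu' hu']; exists (c *: u + u'); first exact: sV'.2.
    by rewrite opprD addrACA -scalerBr; apply: sS.2.
  - by move=> r x [u Vu hu]; exists (ra r u); [apply: rV|rewrite -linB //; apply: rS].
  - by move=> x [u Vu hu]; exists (th u); [apply: tV|rewrite -linB //; apply: tS].
have [||n x|N hN] := @artinian [:: w; v] C.
- by move=> n; apply/stable_ssub.
- move=> n x [u Vu hu]; rewrite -[x](subrK u).
  have sS := sgen_ssub [:: w; v]; apply: (subspD (ssub_subsp sS)).
    apply: hu => // y; rewrite inE => /eqP ->; apply: (ssub_iter n sS); apply: sgen_incl.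
    by rewrite inE eqxx.
  apply: ess => //; exists v => //; apply: sgen_incl; by rewrite !inE eqxx orbT.
- case=> u Vu hu; exists u => //; apply: hu; first exact: sgen_ssub.
  move=> y; rewrite inE => /eqP -> /=; case: (sgen_ssub [:: iter n th w]) => _ _; apply.
  by apply: sgen_incl; rewrite inE.
have [l l0 hl] : exists2 l, (0 < l)%N & forall r, ann w r -> ann w (iter l beta r).
  apply: (ann_periodic (n := N) sV refl pA); apply/(hN N.+1 (leqnSn N)).
  by exists 0; [apply: subsp0|rewrite subr0; apply: sgen_incl; rewrite inE].
by exists l => // i; apply: Am; apply: (pow (ann w)).
Qed.

Lemma findim_least_generic : findim V.
Proof.
have [m [pm qm alg gen]] := exists_generic_max; have [im m1 mP] := pm; have sm' := idl_subsp im.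
have [[sV rV tV] _ ess] := lV.
have [as_ [asm mgen]] := idl_fg fgen im.
have [N N0 hN] : exists2 N, (0 < N)%N & forall a, a \in as_ -> forall i, m (iter (N * i) beta a).
  elim: as_ asm {mgen} => [|a s IH] asm; first by exists 1%N.
  have [N N0 hN] := IH (fun b h => asm b (mem_behead (s := _ :: _) h)).
  have [l l0 hl] := generic_max_periodic pm qm gen (asm a (mem_head _ _)).
  exists (N * l)%N; first by rewrite muln_gt0 N0.
  move=> b; rewrite inE => /orP[/eqP ->|/hN h] i; last by rewrite -mulnA.
  by rewrite [(N * l)%N]mulnC -mulnA.
have mN r : m r -> m (iter N beta r).
  apply: (mgen (fun r => m (iter N beta r))); first exact: idl_iter.
  by move=> a /hN /(_ 1%N); rewrite muln1.
have [n n0 hn] := beta_periodic_mod_prime fgen alphaK pm N0 mN (fun g _ => alg g).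
pose J r := forall i, m (iter i beta r).
have iJ : idl J.
  by split=> [i|x y hx hy i|r x hx i]; have [? ? ?] := idl_iter beta i im; auto.
have Jn r : (forall i, (i < n)%N -> m (iter i beta r)) -> J r.
  move=> h i; elim/ltn_ind: i => i IH; have [/h //|ni] := ltnP i n.
  rewrite -(subnKC ni) iterD -[X in m X](subrK (iter (i - n) beta r)); apply: subspD => //.
  by apply: IH; rewrite ltn_subrL n0 (leq_trans n0).
have Jq r : J r -> q r.
  pose VJ x := exists l, orbit_sum J l x.
  have [J0 JD JM] := iJ.
  have wide l l' x : (l <= l')%N -> orbit_sum J l x -> orbit_sum J l' x.
    move=> /subnK <-; elim: (l' - l)%N => // d IH /IH [t Jt ->].
    exists (fun i => if i == (d + l)%N then 0 else t i) => [i|]; first by case: ifP.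
    rewrite addSn big_ord_recr /= eqxx ra0 addr0.
    by apply: eq_bigr => i _; rewrite ltn_eqF.
  have sVJ : ssub VJ.
    split; first split.
    - by exists 0%N, (fun=> 0); rewrite ?big_ord0.
    - move=> c x y [l hx] [l' hy]; exists (maxn l l').
      have [t Jt ->] := wide _ (maxn l l') _ (leq_maxl _ _) hx.
      have [u Ju ->] := wide _ (maxn l l') _ (leq_maxr _ _) hy.
      exists (fun i => c%:A * t i + u i) => [i|]; first by apply: (JD); [apply: (JM)|].
      rewrite scaler_sumr -big_split; apply: eq_bigr => i _ /=.
      by rewrite (raD sm) (raM sm) (raC sm).
    - move=> s x [l [t Jt ->]]; exists l, (fun i => s * t i) => [i|]; first exact: JM.
      by rewrite lin_sum //; apply: eq_bigr => i _; rewrite (raM sm).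
    - move=> x [l [t Jt ->]]; exists l.+1, (fun i => if i is i'.+1 then beta (t i') else 0).
        by case=> // i i'; rewrite -iterSr; apply: Jt.
      rewrite lin_sum // big_ord_recl ra0 add0r.
      by apply: eq_bigr => i _; rewrite th_ra.
  move=> Jr; apply/eqP/negPn/negP => nr.
  have [l [t Jt e]] : VJ v.
    apply: ess => //; exists (ra r v) => //; exists 1%N, (fun=> r) => //.
    by rewrite big_ord1.
  by apply: (gen l 1) => //; exists t; [move=> i; apply: (Jt i 0%N)|rewrite ra1].
have hnv r : ra (iter n beta r - r) v = 0.
  by apply: Jq => i; rewrite iter_rmorphB -iterD addnC iterD; apply: hn.
have {}hnv := least_ssub_central_power lV Vv nv hnv.
have zcomm r x : V x -> ra r (iter n th x) = iter n th (ra r x).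
  move=> Vx; rewrite ra_iter_th; congr (iter n th _); apply/eqP; rewrite eq_sym -subr_eq0 -raB.
  by have := hnv x (iter n alpha r) Vx; rewrite (iter_alphaK alphaK) => ->.
have [||||p p0 hp] := @central_algebraic V (iter n th) lV.
- exact: lin_iter.
- by move=> x; apply: ssub_iter.
- exact: zcomm.
- by move=> x _; rewrite -iterS iterSr.
apply: (findim_sub (fun x => (least_ssub_sgen lV Vv nv x).1)).
apply: (@sgen_findim _ n p) => //.
(* Membership in [J] is tested on the first [n] iterates of [beta], so the product of the
   polynomials of [g], [beta g], ... serves for [g]. *)
- move=> g _; have /choice [pi hpi] i : exists p, p != 0 /\ m (pev (iter i beta g) p).
    by have [p' ? ?] := alg (iter i beta g); exists p'.
  exists (\prod_(i < n) pi i); first by apply/prodf_neq0 => i _; case: (hpi i).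
  move=> e; rewrite inE => /eqP ->; rewrite -ra_pev; apply: Jq; apply: Jn => i lt.
  rewrite iter_pev (bigD1 (Ordinal lt)) //= pev_mul.
  by apply: idlMr => //; case: (hpi i).
- by move=> r x /(least_ssub_sgen lV Vv nv); apply: zcomm.
- by move=> e; rewrite inE => /eqP ->; apply: hp.
Qed.

End Generic.

End SkewModules.

(** * Injective hulls *)

Lemma zorn_above (T : Type) (P : set T -> Prop) (A0 : set T) : P A0 ->
  (forall F : set (set T), (exists A, F A) -> (forall A, F A -> P A) -> total_on F subset ->
     P (\bigcup_(X in F) X)%classic) ->
  exists A, [/\ (A0 `<=` A)%classic, P A & forall B, (A `<=` B)%classic -> P B -> (B `<=` A)%classic].
Proof.
(* [Zorn_bigcup] also asks for the union of the empty chain, so the empty set is added to the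
   family; it can be maximal only if [A0] is empty. *)
move=> PA0 hP; pose P' (A : set T) := A = set0 \/ ((A0 `<=` A)%classic /\ P A).
have [|A [PA hmax]] := @Zorn_bigcup T P'.
  move=> F FP tot; have [[X [FX nX]]|no] := pselect (exists X, F X /\ X <> set0); last first.
    left; apply/seteqP; split=> // x [X FX Xx]; apply: no; exists X; split=> // X0.
    by rewrite X0 in Xx.
  pose F' := [set X | F X /\ X <> set0]%classic.
  have e : (\bigcup_(X in F) X = \bigcup_(X in F') X)%classic.
    apply/seteqP; split=> x [Y FY Yx]; exists Y => //; last by case: FY.
    by split=> // Y0; rewrite Y0 in Yx.
  have F'P Y : F' Y -> (A0 `<=` Y)%classic /\ P Y by case=> /FP [].
  right; rewrite e; split.
    by move=> x A0x; exists X => //; apply: (F'P X _).1.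
  apply: hP; [by exists X|by move=> Y /F'P []|].
  by move=> Y Z [FY _] [FZ _]; apply: tot.
have maxA B : (A `<=` B)%classic -> P' B -> (B `<=` A)%classic.
  move=> AB PB; apply: contrapT => nBA; apply: (hmax B) => //; split=> //.
case: PA => [A_0|[A0A PA]]; last first.
  by exists A; split=> // B AB PB; apply: maxA => //; right; split=> // x /A0A /AB.
have A00 : (A0 `<=` A)%classic.
  by apply: maxA; [rewrite A_0; apply: sub0set|right; split].
have eA : A = A0 by apply/seteqP; split=> //; rewrite A_0; apply: sub0set.
exists A0; split=> // B A0B PB; rewrite -[X in (_ `<=` X)%classic]eA; apply: maxA.
  by rewrite eA.
by right.
Qed.

Section LinearExtension.
Variables (k : fieldType) (N W : lmodType k).

(** Zorn's lemma on functional linear relations: one whose domain misses [x] can be enlarged by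
    sending [x] to 0. *)
Lemma linear_graph_extension (G : N -> W -> Prop) :
  G 0 0 -> (forall c x y u v, G x u -> G y v -> G (c *: x + y) (c *: u + v)) ->
  (forall u, G 0 u -> u = 0) ->
  exists h : N -> W, (forall c x y, h (c *: x + y) = c *: h x + h y) /\ forall x u, G x u -> h x = u.
Proof.
move=> G0 GD Gf.
pose good (A : set (N * W)) := [/\ A (0, 0),
  forall (c : k) x y, A x -> A y -> A (c *: x.1 + y.1, c *: x.2 + y.2) & forall u, A (0, u) -> u = 0].
have [||A [GA [A0 AD Af] hmax]] := @zorn_above _ good [set x | G x.1 x.2]%classic.
- by split=> // c x y /=; apply: GD.
- move=> F [A1 FA1] hF tot; split.
  + by exists A1 => //; case: (hF _ FA1).
  + move=> c x y [X FX Xx] [Y FY Yy]; have [XY|YX] := tot _ _ FX FY.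
      by exists Y => //; case: (hF _ FY) => _ h _; apply: h => //; apply: XY.
    by exists X => //; case: (hF _ FX) => _ h _; apply: h => //; apply: YX.
  + by move=> u [X FX Xu]; case: (hF _ FX) => _ _; apply.
have tot x : exists u, A (x, u).
  apply: contrapT => nx.
  pose B := [set y | exists2 c : k, True & A (y.1 - c *: x, y.2)]%classic.
  apply: (nx); exists 0; apply: (hmax B).
  - by move=> y Ay; exists 0 => //; rewrite scale0r subr0; case: y Ay.
  - split.
    + by exists 0 => //; rewrite scale0r subr0.
    + move=> c y z [d _ hy] [e _ hz]; exists (c * d + e) => //=.
      by have := AD c _ _ hy hz; rewrite /= scalerBr scalerA addrACA -opprD -scalerDl.
    + move=> u [c _] /=; rewrite sub0r; have [->|c0] := eqVneq c 0.
        by rewrite scale0r oppr0; apply: Af.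
      move=> h; exfalso; apply: nx; exists (- c^-1 *: u).
      have := AD (- c^-1) _ _ h A0.
      by rewrite /= !addr0 scalerN scaleNr opprK scalerA mulVf // scale1r.
  - by exists 1 => //=; rewrite scale1r subrr.
have [h hh] := choice tot.
have uniq x u : A (x, u) -> h x = u.
  move=> Axu; have := AD (-1) _ _ (hh x) Axu; rewrite /= !scaleN1r !addNr => /Af /eqP.
  by rewrite addrC subr_eq0 => /eqP.
exists h; split=> [c x y|x u Gxu]; last by apply: uniq; apply: GA.
by apply: uniq; apply: (AD c _ _ (hh x) (hh y)).
Qed.

End LinearExtension.

(** * Submodules as modules *)

Section SubmoduleLmod.
Variables (A : pzRingType) (M : lmodType A) (P : M -> Prop) (hP : submodule P).

Record submod : Type := Submod { submod_val : M; submod_prop : P submod_val }.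

Lemma submod_val_inj : injective submod_val.
Proof. by case=> x px [y py] /= e; subst y; congr Submod; apply: Prop_irrelevance. Qed.

Lemma submoduleN x : P x -> P (- x).
Proof. by case: hP => _ _ h Px; rewrite -scaleN1r; apply: h. Qed.

Let P0 : P 0. Proof. by case: hP. Qed.
Let PD x y : P x -> P y -> P (x + y). Proof. by case: hP => _ + _; apply. Qed.
Let PZ a x : P x -> P (a *: x). Proof. by case: hP => _ _; apply. Qed.

(* The unused proof [hP] makes the module structure inferable from the type. *)
Definition submod_of (_ : submodule P) : Type := submod.
Notation T := (submod_of hP).

HB.instance Definition _ := gen_eqMixin T.
HB.instance Definition _ := gen_choiceMixin T.

Definition submod_add (x y : T) : T := Submod (PD (submod_prop x) (submod_prop y)).
Definition submod_opp (x : T) : T := Submod (submoduleN (submod_prop x)).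
Definition submod_scale a (x : T) : T := Submod (PZ a (submod_prop x)).

Fact submod_addA : associative submod_add.
Proof. by move=> x y z; apply: submod_val_inj; apply: addrA. Qed.
Fact submod_addC : commutative submod_add.
Proof. by move=> x y; apply: submod_val_inj; apply: addrC. Qed.
Fact submod_add0 : left_id (Submod P0 : T) submod_add.
Proof. by move=> x; apply: submod_val_inj; apply: add0r. Qed.
Fact submod_addN : left_inverse (Submod P0 : T) submod_opp submod_add.
Proof. by move=> x; apply: submod_val_inj; apply: addNr. Qed.

HB.instance Definition _ :=
  GRing.isZmodule.Build T submod_addA submod_addC submod_add0 submod_addN.

Fact submod_scaleA a b (x : T) : submod_scale a (submod_scale b x) = submod_scale (a * b) x.
Proof. by apply: submod_val_inj; apply: scalerA. Qed.
Fact submod_scale1 : left_id 1 submod_scale.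
Proof. by move=> x; apply: submod_val_inj; apply: scale1r. Qed.
Fact submod_scaleDr : right_distributive submod_scale +%R.
Proof. by move=> a x y; apply: submod_val_inj; apply: scalerDr. Qed.
Fact submod_scaleDl (x : T) : {morph submod_scale^~ x : a b / a + b}.
Proof. by move=> a b; apply: submod_val_inj; apply: scalerDl. Qed.

HB.instance Definition _ := GRing.Zmodule_isLmodule.Build A T
  submod_scaleA submod_scale1 submod_scaleDr submod_scaleDl.

Definition submod_in (x : T) : M := submod_val x.

Fact submod_in_linear : linear submod_in.
Proof. by []. Qed.

HB.instance Definition _ := GRing.isLinear.Build A T M _ submod_in submod_in_linear.

Lemma submod_in_inj : injective submod_in.
Proof. exact: submod_val_inj. Qed.

End SubmoduleLmod.

(** * Restriction of scalars *)

Section RestrictedScalars.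
Variables (k : fieldType) (A : pzRingType) (rho : {rmorphism k -> A}) (M : lmodType A).

(** The morphism is an argument of the type so that the [k]-structure can be inferred from the
    type. *)
Definition restr (_ : {rmorphism k -> A}) (M : lmodType A) : Type := M.
Notation T := (restr rho M).

HB.instance Definition _ := GRing.Zmodule.on T.

Definition restr_scale (c : k) (x : T) : T := rho c *: (x : M).

Fact restr_scaleA a b (x : T) : restr_scale a (restr_scale b x) = restr_scale (a * b) x.
Proof. by rewrite /restr_scale scalerA -rmorphM. Qed.
Fact restr_scale1 : left_id 1 restr_scale.
Proof. by move=> x; rewrite /restr_scale rmorph1 scale1r. Qed.
Fact restr_scaleDr : right_distributive restr_scale +%R.
Proof. by move=> a x y; apply: scalerDr. Qed.
Fact restr_scaleDl (x : T) : {morph restr_scale^~ x : a b / a + b}.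
Proof. by move=> a b; rewrite /restr_scale rmorphD scalerDl. Qed.

HB.instance Definition _ := GRing.Zmodule_isLmodule.Build k T
  restr_scaleA restr_scale1 restr_scaleDr restr_scaleDl.

Lemma restr_scaleE c (x : T) : c *: x = rho c *: (x : M).
Proof. by []. Qed.

End RestrictedScalars.

(** * Coinduced modules *)

Section CoinducedModule.
Variables (k : fieldType) (A : pzRingType) (rho : {rmorphism k -> A}).
Variable V : lmodType A.

Definition klinear (f : A -> V) := forall c a b, f (rho c * a + b) = rho c *: f a + f b.

(** [Hom_k(A, V)], which becomes an [A]-module by [(a f)(b) = f(b a)]. *)
Record coind : Type := Coind { coind_fun :> A -> V; coind_lin : klinear coind_fun }.

Lemma coindP (f g : coind) : (forall a, f a = g a) -> f = g.
Proof.
case: f g => f fL [g gL] /= /funext e; subst g; congr Coind; exact: Prop_irrelevance.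
Qed.

HB.instance Definition _ := gen_eqMixin coind.
HB.instance Definition _ := gen_choiceMixin coind.

Fact coind0_lin : klinear (fun=> 0).
Proof. by move=> c a b; rewrite scaler0 addr0. Qed.
Fact coindD_lin (f g : coind) : klinear (fun a => f a + g a).
Proof. by move=> c a b; rewrite !coind_lin scalerDr addrACA. Qed.
Fact coindN_lin (f : coind) : klinear (fun a => - f a).
Proof. by move=> c a b; rewrite coind_lin opprD scalerN. Qed.
Fact coindZ_lin a (f : coind) : klinear (fun b => f (b * a)).
Proof. by move=> c b b'; rewrite mulrDl -mulrA coind_lin. Qed.

Definition coind_add f g := Coind (coindD_lin f g).
Definition coind_opp f := Coind (coindN_lin f).
Definition coind_scale a f := Coind (coindZ_lin a f).

Lemma coind_addr (f : coind) a b : f (a + b) = f a + f b.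
Proof. by have := coind_lin f 1 a b; rewrite rmorph1 mul1r scale1r. Qed.

Lemma coind_scalr (f : coind) c a : f (rho c * a) = rho c *: f a.
Proof.
have f0 : f 0 = 0 by apply: (addrI (f 0)); rewrite -coind_addr !addr0.
by have := coind_lin f c a 0; rewrite f0 !addr0.
Qed.

Fact coind_addA : associative coind_add.
Proof. by move=> f g h; apply: coindP => a; apply: addrA. Qed.
Fact coind_addC : commutative coind_add.
Proof. by move=> f g; apply: coindP => a; apply: addrC. Qed.
Fact coind_add0 : left_id (Coind coind0_lin) coind_add.
Proof. by move=> f; apply: coindP => a; apply: add0r. Qed.
Fact coind_addN : left_inverse (Coind coind0_lin) coind_opp coind_add.
Proof. by move=> f; apply: coindP => a; apply: addNr. Qed.

HB.instance Definition _ :=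
  GRing.isZmodule.Build coind coind_addA coind_addC coind_add0 coind_addN.

Fact coind_scaleA a b f : coind_scale a (coind_scale b f) = coind_scale (a * b) f.
Proof. by apply: coindP => c; rewrite /= mulrA. Qed.
Fact coind_scale1 : left_id 1 coind_scale.
Proof. by move=> f; apply: coindP => c; rewrite /= mulr1. Qed.
Fact coind_scaleDr : right_distributive coind_scale +%R.
Proof. by move=> a f g; apply: coindP. Qed.
Fact coind_scaleDl f : {morph coind_scale^~ f : a b / a + b}.
Proof. by move=> a b; apply: coindP => c; rewrite /= mulrDr coind_addr. Qed.

HB.instance Definition _ := GRing.Zmodule_isLmodule.Build A coind
  coind_scaleA coind_scale1 coind_scaleDr coind_scaleDl.

Fact to_coind_lin (v : V) : klinear (fun a => a *: v).
Proof. by move=> c a b; rewrite scalerDl scalerA. Qed.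

Definition to_coind v : coind := Coind (to_coind_lin v).

Fact to_coind_linear : linear to_coind.
Proof.
move=> a u v; apply: coindP => b.
by rewrite -[RHS]/((b * a) *: u + b *: v) /= scalerDr scalerA.
Qed.

HB.instance Definition _ := GRing.isLinear.Build A V coind _ to_coind to_coind_linear.

Lemma to_coind_inj : injective to_coind.
Proof. by move=> u v /(congr1 (fun f : coind => f 1)) /=; rewrite !scale1r. Qed.

(** Evaluation at 1 identifies [A]-linear maps into [Hom_k(A, V)] with [k]-linear maps into [V], and
    the latter always extend. *)
Lemma coind_injective : injective_module coind.
Proof.
move=> M N f g f_inj.
pose G (n : restr rho N) (w : restr rho V) := exists2 m, n = f m & w = g m 1.
have [||| h0 [h0L h0G]] := @linear_graph_extension k (restr rho N) (restr rho V) G.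
- by exists 0; rewrite linear0.
- move=> c _ _ _ _ [m -> ->] [m' -> ->]; exists (rho c *: m + m'); first by rewrite linearP.
  rewrite linearP -[RHS]/(g m (1 * rho c) + g m' 1) mul1r -[X in _ = coind_fun (g m) X + _]mulr1 coind_scalr.
  by [].
- by move=> u [m e ->]; rewrite (f_inj m 0) ?linear0 // -e.
have h0D x y : h0 (x + y) = h0 x + h0 y by have := h0L 1 x y; rewrite !scale1r.
have h0Z c (x : N) (y : N) : h0 (rho c *: x + y) = rho c *: (h0 x : V) + h0 y by apply: h0L.
have hl n : klinear (fun b => h0 (b *: n) : V).
  by move=> c a b; rewrite scalerDl -scalerA h0Z.
pose h n : coind := Coind (hl n).
have hL : linear h.
  move=> a x y; apply: coindP => b.
  by rewrite -[RHS]/(h0 ((b * a) *: x) + h0 (b *: y)) /= scalerDr h0D scalerA.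
pose hh : {linear N -> coind} := HB.pack h (GRing.isLinear.Build A N coind _ h hL).
exists hh => m; apply: coindP => b /=.
rewrite -linearZ (h0G _ (g (b *: m) 1)); last by exists (b *: m).
by rewrite linearZ -[LHS]/(g m (1 * b)) mul1r.
Qed.

End CoinducedModule.

(** * Injective hulls inside an injective module *)

Section InjectiveHull.
Variables (A : pzRingType) (V F : lmodType A) (i : {linear V -> F}).
Hypotheses (i_inj : injective i) (F_inj : injective_module F).

(** The essential extensions of the image of [V] inside [F]. *)
Let extension (E : set F) := [/\ submodule E, forall v, E (i v) &
  forall P : F -> Prop, submodule P -> (forall x, P x -> E x) -> (exists x, P x /\ x != 0) ->
    exists v, v != 0 /\ P (i v)].

Let range_extension : extension (fun x => exists v, x = i v).
Proof.
split; last 2 first.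
- by move=> v; exists v.
- move=> P sP Pi [x [Px nx]]; have [v xv] := Pi _ Px; exists v; rewrite -xv; split=> //.
  by apply: contraNneq nx => v0; rewrite xv v0 linear0.
split; first by exists 0; rewrite linear0.
- by move=> _ _ [u ->] [v ->]; exists (u + v); rewrite linearD.
- by move=> a _ [u ->]; exists (a *: u); rewrite linearZ.
Qed.

Lemma submodule_bigcup (S : set (set F)) : (exists X, S X) -> (forall X, S X -> submodule X) ->
  total_on S subset -> submodule (\bigcup_(X in S) X)%classic.
Proof.
move=> [X SX] sub tot; split.
- by exists X => //; case: (sub _ SX).
- move=> x y [Y SY Yx] [Z SZ Zy]; have [YZ|ZY] := tot _ _ SY SZ.
    by exists Z => //; case: (sub _ SZ) => _ h _; apply: h => //; apply: YZ.
  by exists Y => //; case: (sub _ SY) => _ h _; apply: h => //; apply: ZY.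
- by move=> a x [Y SY Yx]; exists Y => //; case: (sub _ SY) => _ _; apply.
Qed.

Lemma max_extension : exists E, extension E /\
  forall B, (forall x, E x -> B x) -> extension B -> forall x, B x -> E x.
Proof.
have [|E [_ xE hE]] := @zorn_above F extension _ range_extension; last by exists E.
move=> S [X SX] hS tot; split.
- by apply: submodule_bigcup => //; [exists X|move=> Y /hS []].
- by move=> v; exists X => //; case: (hS _ SX).
- move=> P [P0 PD PZ] PS [x [Px nx]]; have [Y SY Yx] := PS _ Px.
  have [[Y0 YD YZ] _ hY] := hS _ SY.
  have [|z []||v [nv [Pv _]]] := hY (fun z => P z /\ Y z); last by exists v.
  + split=> //; first by move=> z t [? ?] [? ?]; split; [apply: PD|apply: YD].
    by move=> a z [? ?]; split; [apply: PZ|apply: YZ].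
  + by [].
  + by exists x.
Qed.

(* A maximal essential extension of [V] inside [F] is a direct summand of [F]. *)
Lemma injective_hull_in : exists (E : lmodType A) (f : {linear V -> E}), injective_hull f.
Proof.
have [E [[sE Ei Ess] maxE]] := max_extension; have [E0 ED EZ] := sE.
have EN x : E x -> E (- x) by apply: submoduleN.
pose disj (C : set F) := submodule C /\ forall x, C x -> E x -> x = 0.
have sub0 : submodule (fun x : F => x = 0).
  by split=> // [x y -> ->|a x ->]; rewrite ?addr0 ?scaler0.
have [||C [_ [sC CE] maxC]] := @zorn_above F disj (fun x => x = 0).
- by split.
- move=> S exS hS tot; split; first by apply: submodule_bigcup => // Y /hS [].
  by move=> x [Y SY Yx]; apply: (hS _ SY).2.
have [C0 CD CZ] := sC; have CN x : C x -> C (- x) by apply: submoduleN.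
have uniq e e' x : E e -> E e' -> C (x - e) -> C (x - e') -> e = e'.
  move=> Ee Ee' Ce Ce'; apply/eqP; rewrite -subr_eq0; apply/eqP; apply: CE; last by apply: ED => //; apply: EN.
  have -> : e - e' = (x - e') - (x - e) by rewrite opprB [RHS]addrC addrA subrK.
  by apply: CD => //; apply: CN.
(* The projection of [E + C] onto [E] along [C], read as a map to [F], extends to [h] on [F] by
   injectivity; [h] will be a retraction onto [E] with kernel [C]. *)
pose EC x := exists2 e, E e & C (x - e).
have sEC : submodule EC.
  split; first by exists 0; rewrite ?subr0.
  - move=> x y [e Ee Ce] [e' Ee' Ce']; exists (e + e'); first exact: ED.
    by rewrite opprD addrACA; apply: CD.
  - by move=> a x [e Ee Ce]; exists (a *: e); [apply: EZ|rewrite -scalerBr; apply: CZ].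
have /choice [g hg] (x : submod_of sEC) : exists e, E e /\ C (submod_in x - e).
  by case: x => x [e Ee Ce]; exists e.
have gL : linear g.
  move=> a x y; have [[Ex Cx] [Ey Cy]] := (hg x, hg y); have [Exy Cxy] := hg (a *: x + y).
  apply: (uniq _ _ (submod_in (a *: x + y))) => //; first by apply: ED => //; apply: EZ.
  rewrite linearP opprD addrACA -scalerBr; apply: CD => //; exact: CZ.
pose gg : {linear submod_of sEC -> F} := HB.pack g (GRing.isLinear.Build A _ F _ g gL).
have [h hh] := F_inj gg (@submod_in_inj _ _ _ sEC).
have hE x : E x -> h x = x.
  move=> Ex; have ECx : EC x by exists x; rewrite ?subrr.
  have [Eg Cg] := hg (Submod ECx); have := hh (Submod ECx); rewrite /= => ->.
  by apply: (uniq _ _ x) => //; rewrite subrr.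
have hC x : C x -> h x = 0.
  move=> Cx; have ECx : EC x by exists 0; rewrite ?subr0.
  have [Eg Cg] := hg (Submod ECx); have := hh (Submod ECx); rewrite /= => ->.
  by apply: (uniq _ _ x) => //; rewrite subr0.
have kerC x : h x = 0 -> C x.
  apply: (maxC (fun x => h x = 0)); first by move=> y; apply: hC.
  split; last by move=> y hy Ey; rewrite -(hE y Ey).
  split; first exact: linear0.
  - by move=> y z hy hz; rewrite linearD hy hz addr0.
  - by move=> a y hy; rewrite linearZ /= hy scaler0.
(* By maximality of [E] it suffices that the image of [h] is essential over [V]. If [h z] is
   nonzero, [z] is outside [C], so by maximality of [C] some nonzero [c + a z] lies in [E]; it is
   fixed by [h], hence equal to [a (h z)]. *)
have imE x : E (h x).
  apply: (maxE (fun y => exists x, y = h x)); last by exists x.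
    by move=> y Ey; exists y; rewrite hE.
  split; last 2 first.
  - by move=> v; exists (i v); rewrite hE.
  - move=> P sP Pim [y [Py ny]]; have [P0 PD PZ] := sP; have [z yz] := Pim _ Py.
    have [[e [ne [Ee [a [c [Cc ec]]]]]]|no] := pselect
      (exists e, e != 0 /\ (E e /\ exists a c, C c /\ e = c + a *: z)).
      have [|||v [nv [Pv _]]] := Ess (fun t => P t /\ E t); last by exists v.
      + split=> //; first by move=> s t [? ?] [? ?]; split; [apply: PD|apply: ED].
        by move=> b s [? ?]; split; [apply: PZ|apply: EZ].
      + by move=> t [].
      + exists e; split=> //; split=> //.
        have -> : e = a *: y by rewrite -(hE e Ee) ec linearD (hC c Cc) add0r linearZ /= yz.
        exact: PZ.
    case/eqP: ny; rewrite yz; apply: hC; apply: (maxC (fun e => exists a c, C c /\ e = c + a *: z)).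
    + by move=> c Cc; exists 0, c; rewrite scale0r addr0.
    + split; last first.
        by move=> t ht Et; apply/eqP/negPn/negP => nt; apply: no; exists t.
      split; first by exists 0, 0; rewrite scale0r addr0.
      * move=> _ _ [a [c [Cc ->]]] [b [d [Cd ->]]]; exists (a + b), (c + d).
        by split; [apply: CD|rewrite scalerDl addrACA].
      * move=> b _ [a [c [Cc ->]]]; exists (b * a), (b *: c).
        by split; [apply: CZ|rewrite scalerDr scalerA].
    + by exists 1, 0; rewrite scale1r add0r.
  split; first by exists 0; rewrite linear0.
  - by move=> _ _ [y ->] [z ->]; exists (y + z); rewrite linearD.
  - by move=> a _ [y ->]; exists (a *: y); rewrite linearZ.
pose ET := submod_of sE.
pose r (x : F) : ET := Submod (imE x).
have rL : linear r by move=> a x y; apply: submod_in_inj; rewrite [LHS]linearP linearP.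
pose f0 (v : V) : ET := Submod (Ei v).
have f0L : linear f0 by move=> a x y; apply: submod_in_inj; rewrite [LHS]linearP linearP.
pose rr : {linear F -> ET} := HB.pack r (GRing.isLinear.Build A F ET _ r rL).
pose f : {linear V -> ET} := HB.pack f0 (GRing.isLinear.Build A V ET _ f0 f0L).
exists (ET : lmodType A), f; split.
- by move=> u v /(congr1 (@submod_in _ _ _ sE)) /i_inj.
- move=> M N j gM j_inj.
  have [H HH] := F_inj (@submod_in _ _ _ sE \o gM : {linear M -> F}) j_inj.
  exists (rr \o H : {linear N -> ET}) => m; apply: submod_in_inj.
  by rewrite /= HH -[LHS]/(h (submod_in (gM m))) hE //; case: (gM m).
- move=> P [P0 PD PZ] [x [Px nx]].
  have [||| v [nv [y Py e]]] := Ess (fun t => exists2 y : ET, P y & t = @submod_in _ _ _ sE y).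
  + split; first by exists 0; rewrite ?linear0.
    * by move=> _ _ [y Py ->] [z Pz ->]; exists (y + z); rewrite ?linearD //; apply: PD.
    * by move=> a _ [y Py ->]; exists (a *: y); rewrite ?linearZ //; apply: PZ.
  + by move=> _ [y _ ->]; case: y.
  + exists (@submod_in _ _ _ sE x); split; first by exists x.
    by apply: contraNneq nx => x0; apply/eqP; apply: submod_in_inj; rewrite x0 linear0.
  exists v; split=> //; suff -> : f v = y by [].
  exact: submod_in_inj.
Qed.

End InjectiveHull.

(** * Passage to modules over S *)

Lemma lrmorphism_inverse (k : fieldType) (R : comAlgType k) (alpha : {lrmorphism R -> R}) :
  bijective alpha -> exists beta : {lrmorphism R -> R}, cancel alpha beta /\ cancel beta alpha.
Proof.
case=> b aK bK; have a_inj := can_inj aK.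
have bL : linear b by move=> c x y; apply: a_inj; rewrite linearP /= !bK.
have bM : monoid_morphism b.
  by split=> [|x y]; apply: a_inj; rewrite ?rmorph1 ?rmorphM /= !bK.
pose beta : {lrmorphism R -> R} := HB.pack b (GRing.isLinear.Build k R R _ b bL)
  (GRing.isMonoidMorphism.Build R R b bM).
by exists beta.
Qed.

Section SkewPolynomialModules.
Variables (k : fieldType) (R : comAlgType k) (alpha : {lrmorphism R -> R}) (S : nzRingType).
Variables (iota : {rmorphism R -> S}) (theta : S).
Hypothesis skew : is_skew_poly alpha iota theta.

Let theta_iota r : theta * iota r = iota (alpha r) * theta. Proof. by case: skew. Qed.

Definition scalars (c : k) : S^c := iota c%:A.

Lemma scalars_central c (s : S) : iota c%:A * s = s * iota c%:A.
Proof.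
have [_ /(_ s) [n [t ->]] _] := skew.
rewrite mulr_sumr mulr_suml; apply: eq_bigr => i _.
rewrite mulrA -rmorphM mulrC rmorphM -!mulrA; congr (_ * _).
elim: (nat_of_ord i) => [|m IH]; first by rewrite mul1r mulr1.
by rewrite exprS -mulrA -IH !mulrA theta_iota linearZ /= rmorph1.
Qed.

Fact scalars_zmod : zmod_morphism scalars.
Proof. by move=> a b; rewrite /scalars scalerBl rmorphB. Qed.

Fact scalars_monoid : monoid_morphism scalars.
Proof.
split=> [|a b]; first by rewrite /scalars scale1r rmorph1.
rewrite -[RHS]/(iota b%:A * iota a%:A : S) /scalars -rmorphM.
by rewrite mulr_algl scalerA mulrC.
Qed.

HB.instance Definition _ := GRing.isZmodMorphism.Build k S^c scalars scalars_zmod.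
HB.instance Definition _ := GRing.isMonoidMorphism.Build k S^c scalars scalars_monoid.

Definition rho : {rmorphism k -> S^c} := scalars.

Section Restrict.
Variable M : lmodType S^c.
Local Notation W := (restr rho M).

Definition ract (r : R) (x : W) : W := (iota r : S^c) *: (x : M).
Definition tact (x : W) : W := (theta : S^c) *: (x : M).

Lemma rscaleA (a b : S) (x : M) : (a : S^c) *: ((b : S^c) *: x) = ((b * a : S) : S^c) *: x.
Proof. by rewrite scalerA. Qed.

Lemma restr_skewmod : skewmod alpha ract tact.
Proof.
have act_lin (s : S) : lin (fun x : W => ((s : S^c) *: (x : M)) : W).
  move=> c x y; rewrite scalerDr; congr (_ + _).
  by rewrite restr_scaleE [LHS]rscaleA [RHS]rscaleA scalars_central.
split.
- by move=> r; apply: act_lin.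
- exact: act_lin.
- by move=> r s x; rewrite /ract rmorphD; exact: (scalerDl (x : M) (iota r : S^c) (iota s : S^c)).
- by move=> r s x; rewrite /ract rscaleA -rmorphM mulrC.
- by [].
- by move=> r x; rewrite /ract /tact !rscaleA theta_iota.
Qed.

Lemma iter_tact n (x : M) : ((theta ^+ n : S) : S^c) *: x = iter n tact x.
Proof.
elim: n x => [|n IH] x; first exact: (scale1r x).
by rewrite iterSr exprS -rscaleA IH.
Qed.

Lemma skew_scale n (c : nat -> R) (x : M) :
  ((\sum_(i < n) iota (c i) * theta ^+ i : S) : S^c) *: x = \sum_(i < n) iter i tact (ract (c i) x).
Proof.
elim: n => [|n IH]; first by rewrite !big_ord0; apply: scale0r.
rewrite !big_ord_recr /= -IH [LHS]scalerDl; congr (_ + _).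
by rewrite -rscaleA iter_tact.
Qed.

(** Coefficients are indexed by all of [nat] and vanish from [n] on, so that expansions of different
    lengths can be added. *)
Lemma skew_expand (s : S) : exists n (c : nat -> R),
  (forall i, (n <= i)%N -> c i = 0) /\ s = \sum_(i < n) iota (c i) * theta ^+ i.
Proof.
have [_ /(_ s) [n [c ->]] _] := skew.
exists n, (fun i => oapp c 0 (insub i)); split.
  by move=> i ni; rewrite insubF // ltnNge ni.
by apply: eq_bigr => i _; rewrite valK.
Qed.

Lemma submodule_ssub (P : M -> Prop) : submodule P <-> ssub ract tact P.
Proof.
split=> [[P0 PD PZ]|[[P0 PD] Pr Pt]].
  split; [|by move=> r x; apply: PZ|by move=> x; apply: PZ].
  by split=> // c x y Px Py; apply: PD => //; apply: PZ.
split=> // [x y Px Py|a x Px].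
  by have := PD 1 x y Px Py; rewrite scale1r.
have [n [c [_ ->]]] := skew_expand a; rewrite skew_scale.
have sP : subsp (P : W -> Prop) by split.
apply: (subsp_sum _ sP) => i _; have := Pr (c i) x Px.
by elim: (nat_of_ord i) (ract _ _) => //= m IH y Py; apply: Pt; apply: IH.
Qed.

Lemma sgen_fg (es : seq M) : fg_submodule (sgen ract tact es : M -> Prop).
Proof.
exists es => x; split=> [hx|[c ->]].
  apply: (hx (fun x => exists c : 'I_(size es) -> S^c, x = \sum_(i < size es) c i *: es`_i)).
    apply/submodule_ssub; split.
    - by exists (fun=> 0); rewrite big1 // => i _; rewrite scale0r.
    - move=> _ _ [c ->] [d ->]; exists (fun i => c i + d i).
      by rewrite -big_split; apply: eq_bigr => i _; rewrite scalerDl.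
    - move=> a _ [c ->]; exists (fun i => a * c i).
      by rewrite scaler_sumr; apply: eq_bigr => i _; rewrite scalerA.
  move=> e ees; have lt : (index e es < size es)%N by rewrite index_mem.
  exists (fun i => (i == Ordinal lt)%:R).
  rewrite (bigD1 (Ordinal lt)) //= eqxx scale1r nth_index // big1 ?addr0 //.
  by move=> i /negPf ->; rewrite scale0r.
move=> P sP hP; have [P0 PD PZ] := (submodule_ssub P).2 sP.
apply: (big_ind P) => // i _; apply: PZ; apply: hP; exact: mem_nth.
Qed.

Lemma fg_sgen (es : seq M) (x : M) (c : 'I_(size es) -> S^c) :
  x = \sum_(i < size es) c i *: es`_i -> sgen ract tact es x.
Proof.
move=> -> P sP hP; have [P0 PD PZ] := (submodule_ssub P).2 sP.
apply: (big_ind P) => // i _; apply: PZ; apply: hP; exact: mem_nth.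
Qed.

Lemma k_findimE : k_findim iota M <-> findim (fun _ : W => True).
Proof.
split=> [[vs h]|[vs h]]; exists vs => x; last by have /spn_seqP := h x I.
by move=> _; apply/spn_seqP; apply: h.
Qed.

End Restrict.

(** * A simple module inside its hull *)

Section Hull.
Variables (V E : lmodType S^c) (f : {linear V -> E}).
Hypotheses (simple : simple_module V) (hull : injective_hull f).

Let image (x : restr rho E) := exists v, x = f v.

Let f_lin (c : k) (x y : restr rho V) :
  f (c *: x + y) = c *: (f x : restr rho E) + (f y : restr rho E).
Proof. by rewrite [LHS]linearP. Qed.

Lemma hull_least_ssub : least_ssub (@ract E) (@tact E) image.
Proof.
have [[v nv] simp] := simple; have [f_inj _ ess] := hull; split.
- apply/submodule_ssub; split; first by exists 0; rewrite linear0.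
  + by move=> _ _ [x ->] [y ->]; exists (x + y); rewrite linearD.
  + by move=> a _ [x ->]; exists (a *: x); rewrite linearZ.
- exists (f v); first by exists v.
  by apply: contraNneq nv => e; apply/eqP; apply: f_inj; rewrite e linear0.
- move=> P sP [x Px nx] _ [w ->].
  have sP' := (submodule_ssub P).2 sP; have [P0 PD PZ] := sP'.
  have [|u [nu Pu]] := ess P sP'; first by exists x.
  have [|h|] := simp (fun w => P (f w)); last exact.
    split; first by rewrite linear0.
    + by move=> y z Py Pz; rewrite linearD; apply: PD.
    + by move=> a y Py; rewrite linearZ; apply: PZ.
  by case/eqP: nu; apply: h.
Qed.

Lemma hull_findim : k_findim iota V <-> findim image.
Proof.
rewrite k_findimE; split=> [[vs h]|fI].
  exists (map f vs) => _ [v ->].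
  have sG := spn_subsp (fun y : restr rho E => y \in map f vs).
  apply: (h v I (fun v => spn (fun y : restr rho E => y \in map f vs) (f v))).
    split; first by rewrite linear0; apply: (subsp0 sG).
    by move=> c x y hx hy; rewrite f_lin; apply: sG.2.
  by move=> y yvs; apply: spn_incl; apply: map_f.
have [[[sI _ _] _ _] [f_inj _ _]] := (hull_least_ssub, hull).
have [us [usI h]] := findim_basis sI fI.
have /choice [g hg] u : exists v, u \in us -> u = f v.
  by have [/usI [v ->]|] := boolP (u \in us); [exists v|exists 0].
exists (map g us) => v _.
have : spn (fun y => y \in us) (f v : restr rho E) by apply: h; exists v.
move/(_ (fun x => exists2 w, spn (fun y : restr rho V => y \in map g us) w & x = f w)).
have sG := spn_subsp (fun y : restr rho V => y \in map g us).
case=> [||w hw /f_inj -> //].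
  split; first by exists 0; [apply: (subsp0 sG)|rewrite linear0].
  by move=> c _ _ [x hx ->] [y hy ->]; exists (c *: x + y); [apply: sG.2|rewrite f_lin].
by move=> u uus; exists (g u); [apply: spn_incl; apply: map_f|apply: hg].
Qed.

(* The functional on [S] is assembled from a k-linear map [psi] on [R]. *)
Lemma hull_extend (v : restr rho E) (a : R) : image v -> prime_idl (fun r => ract r v = 0) ->
  ract a v <> 0 ->
  exists2 e : restr rho E, forall r, ract r v = 0 -> ract r e = 0 & ract a e = v.
Proof.
move=> [u vu] [[q0 qD qM] q1 qP] na; have [f_inj E_inj _] := hull.
have smV := restr_skewmod V; have smE := restr_skewmod E.
have thL : lin (@tact V) := th_lin smV.
have qu r : ract r v = 0 -> ract r (u : restr rho V) = 0.
  by rewrite vu /ract -linearZ => h; apply: f_inj; rewrite h linear0.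
(* [psi] is to vanish on the annihilator of [v] and to send [a s] to [u s]. The two prescriptions
   agree because that annihilator is prime and does not contain [a]. *)
pose G (x : R) (w : restr rho V) := exists y s, [/\ ract y v = 0, x = y + a * s & w = ract s u].
have [|||psi [psiL psiG]] := @linear_graph_extension k R (restr rho V) G.
- by exists 0, 0; rewrite mulr0 addr0 (ra0 smV).
- move=> c _ _ _ _ [y [s [qy -> ->]]] [z [t [qz -> ->]]].
  exists (c *: y + z), (c *: s + t); split.
  + by apply: qD => //; rewrite -mulr_algl; apply: qM.
  + by rewrite mulrDr scalerDr -scalerAr addrACA.
  + by rewrite (raD smV) -mulr_algl (raM smV) (raC smV).
- move=> w [y [s [qy e ->]]]; apply: qu.
  have : ract (a * s) v = 0.
    have -> : a * s = - 1 * y by rewrite mulN1r; apply/eqP; rewrite -addr_eq0 addrC -e.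
    exact: qM.
  by case/qP.
have psi0 r : ract r v = 0 -> psi r = 0.
  by move=> qr; apply: psiG; exists r, 0; rewrite mulr0 addr0 (ra0 smV).
have psia s : psi (a * s) = ract s u by apply: psiG; exists 0, s; rewrite add0r.
pose ev n (c : nat -> R) : S := \sum_(i < n) iota (c i) * theta ^+ i.
pose pv n (c : nat -> R) : restr rho V := \sum_(i < n) iter i (@tact V) (psi (c i)).
have psi_lin0 : psi 0 = 0 by apply: psi0; apply: (ra0 smE).
have wide n m c : (n <= m)%N -> (forall i, (n <= i)%N -> c i = 0) -> ev m c = ev n c /\ pv m c = pv n c.
  move=> /subnKC <- c0; rewrite /ev /pv !big_split_ord /=.
  split; rewrite [X in _ + X]big1 ?addr0 // => i _; rewrite c0 ?leq_addr //.
    by rewrite rmorph0 mul0r.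
  by rewrite psi_lin0 lin0 //; apply: lin_iter.
pose N := restr rho (S^c)^o.
(* The functional sends the sum of the [c_i theta^i] to the sum of the [psi(c_i) theta^i]; it is
   single-valued because the powers of [theta] are free over [R]. *)
pose H (s : N) (w : restr rho V) :=
  exists n c, [/\ forall i, (n <= i)%N -> c i = 0, s = ev n c & w = pv n c].
have [||| e [eL eH]] := @linear_graph_extension k N (restr rho V) H.
- by exists 0%N, (fun=> 0); rewrite /ev /pv !big_ord0.
- move=> b _ _ _ _ [n [c [c0 -> ->]]] [m [d [d0 -> ->]]].
  have [<- <-] := wide n (maxn n m) c (leq_maxl _ _) c0.
  have [<- <-] := wide m (maxn n m) d (leq_maxr _ _) d0.
  exists (maxn n m), (fun i => b *: c i + d i); split.
  + by move=> i; rewrite geq_max => /andP[? ?]; rewrite c0 // d0 // scaler0 addr0.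
  + transitivity (ev (maxn n m) c * iota b%:A + ev (maxn n m) d : S); first by [].
    rewrite -scalars_central mulr_sumr -big_split; apply: eq_bigr => i _ /=.
    by rewrite -[b *: c i]mulr_algl rmorphD rmorphM mulrDl mulrA.
  + rewrite scaler_sumr -big_split; apply: eq_bigr => i _ /=.
    by rewrite psiL (lin_iter i thL).
- move=> w [n [c [c0 e ->]]]; rewrite /pv big1 // => i _.
  have [_ _ /(_ n (fun i => c i)) free] := skew.
  by rewrite free // psi_lin0 lin0 //; apply: lin_iter.
have eK : klinear rho (fun s : S^c => e s : V) by move=> b s t; apply: eL.
pose eps : coind rho V := Coind eK.
(* As [E] is injective, [f] extends to [K] on [Hom_k(S, V)]. The wanted vector is [K eps]:
   multiplying [eps] by [a] gives the image of [u], which [K] sends to [v]. *)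
have [K KE] := E_inj _ _ (@to_coind _ _ rho V) f (@to_coind_inj _ _ rho V).
(* The product [b * iota r] of [S^c] is [iota r * b] in [S], so [r] multiplies the coefficients of
   [b]. *)
have eps_iota r (b : S^c) n c : (forall i, (n <= i)%N -> c i = 0) -> b = ev n c ->
    e (b * (iota r : S^c)) = pv n (fun i => r * c i).
  move=> c0 ->; apply: eH; exists n, (fun i => r * c i); split=> //.
    by move=> i /c0 ->; rewrite mulr0.
  transitivity (iota r * ev n c : S); first by [].
  by rewrite mulr_sumr; apply: eq_bigr => i _; rewrite rmorphM mulrA.
exists (K eps : restr rho E) => [r qr|].
  rewrite /ract -linearZ; suff -> : (iota r : S^c) *: eps = 0 by rewrite linear0.
  apply: coindP => b; have [n [c [c0 eb]]] := skew_expand b.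
  rewrite [LHS](eps_iota r b n c c0 eb) /pv big1 // => i _.
  by rewrite psi0 ?lin0 //; [apply: lin_iter|rewrite mulrC; apply: qM].
rewrite /ract -linearZ; suff -> : (iota a : S^c) *: eps = to_coind rho u by rewrite KE.
apply: coindP => b; have [n [c [c0 eb]]] := skew_expand b.
rewrite [LHS](eps_iota a b n c c0 eb) -[RHS]/(b *: u) eb skew_scale.
by apply: eq_bigr => i _; rewrite psia.
Qed.

End Hull.
End SkewPolynomialModules.

Theorem theorem6p1 (k : fieldType) (R : comAlgType k)
    (alpha : {lrmorphism R -> R}) (S : nzRingType)
    (iota : {rmorphism R -> S}) (theta : S) :
  uncountable k -> fg_algebra R -> bijective alpha ->
  is_skew_poly alpha iota theta ->
  (diamond S <-> forall V : lmodType S^c, simple_module V -> k_findim iota V).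
Proof.
move=> unc [gs fgen] alpha_bij skew.
have [beta [alphaK betaK]] := lrmorphism_inverse alpha_bij.
split=> [dia V simple|fin V E f simple hull N sN [es hN] C sC CN decC].
  have [E [f hull]] := injective_hull_in (@to_coind_inj _ _ (rho iota) V) (@coind_injective _ _ (rho iota) V).
  have smE := restr_skewmod skew E.
  have lV := hull_least_ssub skew simple hull.
  apply/(hull_findim skew simple hull).
  have [hth|no] := pselect (exists2 v : restr (rho iota) E, (exists u, v = f u) & tact theta v != 0); last first.
    apply: (findim_least_torsion fgen smE unc lV) => v Vv.
    by apply/eqP/negPn/negP => nv; apply: no; exists v.
  have [v [Vv nv pq [j j0 hj]]] := least_ssub_prime_ann fgen betaK smE lV hth.
  apply: (findim_least_generic fgen alphaK betaK smE unc lV hth Vv nv pq j0 hj).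
    move=> es C sC CN decC.
    have sg := (submodule_ssub skew _).2 (sgen_ssub (ract (M:=E)) (tact theta (M:=E)) es).
    apply: (dia V E f simple hull _ sg (sgen_fg skew es) C) => // [n|x Cx].
      by apply/(submodule_ssub skew)/stable_ssub.
    exact: CN Cx.
  by move=> a na; apply: (hull_extend skew hull Vv pq na).
have smE := restr_skewmod skew E.
have lV := hull_least_ssub skew simple hull.
have fV := (hull_findim skew simple hull).1 (fin V simple).
have fN := findim_extension fgen alphaK betaK smE es lV fV.
apply: (findim_chaincond (up := false) fN) => //.
- by move=> n; split=> //; apply: ssub_subsp; apply/(submodule_ssub skew); apply: sC.
- move=> n x Cx; have /hN [c xc] : N x; last exact: (fg_sgen skew xc).
  by apply: CN; elim: n Cx => // n IH /decC.
Qed.
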